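(* Consider the Clipped FedSMD algorithm described in the context, run for iterations $t=1,2,\dots$, under Assumptions (A1), (A3), (A4). Fix $\delta\in(0,1)$, $p\in(1,2]$ and $\sigma$ from (A1), $0<\kappa<1$, $0<\mu<1$ with $\kappa\ge\max\{\mu+\frac12,1-\mu(p-1)\}$, and $\gamma>1$. Let $$\alpha_t=\frac{1}{(1+\log t)^\gamma t^{\kappa-\mu}}\min\Big\{\frac1{t^\mu},\frac1{2G}\Big\},\qquad\lambda_t=\max\{t^\mu,2G\}.$$ Let $A=\log\frac1\delta+2m\mathcal PC_1+4\sigma^pC_2+16m\sigma^{2p}C_3+40m\sigma^p(1+3m)C_4+40m^2\sigma^pC_5+8m$, where $C_1=\sum_{t\ge1}\alpha_t\alpha_{\tau(t)}\lambda_t\lambda_{\tau(t)}$, $C_2=\sum_{t\ge1}\alpha_t\lambda_t^{1-p}$, $C_3=\sum_{t\ge1}\alpha_t^2\lambda_t^{2-2p}$, $C_4=\sum_{t\ge1}(\alpha_t\lambda_t)^2\lambda_t^{-p}$, $C_5=\sum_{t\ge1}(\alpha_t\lambda_t)^4\lambda_t^{-p}$. Then for any agent $\ell\in[m]$, with probability at least $1-\delta$, for any $T\in\mathbb N$, $$f(\widehat x^T_\ell)-f(x^* )\le\frac1{T\alpha_T}\,m^2(R_1+10A)^2,\qquad\widehat x^T_\ell=\frac1T\sum_{t=1}^Tx_{\ell,t}.$$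
   Context: Setting: $m,n\in\mathbb N$, $\|\cdot\|$ Euclidean norm on $\mathbb R^n$, $\mathcal X\subset\mathbb R^n$ nonempty closed convex, $f_i:\mathcal X\to\mathbb R$ convex differentiable ($i\in[m]$), $f=\sum_if_i$, $x^*\in\mathcal X$ a minimizer of $f$. $\Phi:\mathcal X\to\mathbb R$ differentiable, $1$-strongly convex ($\Phi(x)-\Phi(y)\ge\langle\nabla\Phi(y),x-y\rangle+\frac12\|x-y\|^2$), $D_\Phi(x\|y)=\Phi(x)-\Phi(y)-\langle\nabla\Phi(y),x-y\rangle$. Agent $i$ queried at $x$ receives a random $\widehat\nabla f_i(x)$; $\widetilde\nabla_\lambda f_i(x)=\min\{1,\lambda/\|\widehat\nabla f_i(x)\|\}\widehat\nabla f_i(x)$. Clipped FedSMD: communication period $\mathcal P\in\mathbb N$, communication instants $\{1+k\mathcal P:k\ge1\}$. From $x_{i,1}\in\mathcal X$, for each $t\ge1$ each agent $i$ sets $y_{i,t+1}=\arg\min_{x\in\mathcal X}\{\langle\widetilde\nabla_{\lambda_t}f_i(x_{i,t}),x\rangle+\frac1{\alpha_t}D_\Phi(x\|x_{i,t})\}$, and $x_{i,t+1}=\frac1m\sum_jy_{j,t+1}$ if $t+1$ is a communication instant, else $x_{i,t+1}=y_{i,t+1}$. $\tau(t)=\max\{1+k\mathcal P:k\ge1,1+k\mathcal P\le t\}$ if $t>1+\mathcal P$, $\tau(t)=1$ if $1\le t\le1+\mathcal P$. $\mathcal F_t$ is the $\sigma$-algebra generated by $\{\widehat\nabla f_i(x_{i,s}):i\in[m],s\le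 t\}$, $\mathcal F_0$ trivial. Assumptions: (A1) $\mathbb E[\widehat\nabla f_i(x_{i,t})\mid\mathcal F_{t-1}]=\nabla f_i(x_{i,t})$ and $\mathbb E[\|\widehat\nabla f_i(x_{i,t})-\nabla f_i(x_{i,t})\|^p\mid\mathcal F_{t-1}]\le\sigma^p$, $\sigma>0$, $p\in(1,2]$; (A3) $D_\Phi(x\|\sum_ja_jy_j)\le\sum_ja_jD_\Phi(x\|y_j)$ for all $x,y_j\in\mathcal X$, $a_j\ge0$, $\sum_ja_j=1$; (A4) there is $G>0$ with $\|\nabla f_i(x)\|\le G$ for all $i\in[m]$, $x\in\mathcal X$. $R_1=\max_{i\in[m]}\sqrt{2D_\Phi(x^*\|x_{i,1})}$ (or a known upper bound of it). *)

(* Defs.v *)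
From HB Require Import structures.
From mathcomp Require Import all_boot all_order all_algebra.
From mathcomp Require Import all_classical all_reals all_analysis.
Set Implicit Arguments. Unset Strict Implicit. Unset Printing Implicit Defensive.
Import Order.TTheory GRing.Theory Num.Theory.
Import numFieldNormedType.Exports.
Local Open Scope classical_set_scope.
Local Open Scope ring_scope.

Section Defs.
Context {R : realType} {n : nat}.

Definition dotv (x y : 'rV[R]_n) : R := \sum_(k < n) x ord0 k * y ord0 k.
Definition enorm (x : 'rV[R]_n) : R := Num.sqrt (dotv x x).

Definition convex_on (X : set 'rV[R]_n) (h : 'rV[R]_n -> R) : Prop :=
  forall x y (a : R), X x -> X y -> 0 <= a <= 1 ->
    h (a *: x + (1 - a) *: y) <= a * h x + (1 - a) * h y.

Definition gradient_on (X : set 'rV[R]_n) (h : 'rV[R]_n -> R)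
  (gh : 'rV[R]_n -> 'rV[R]_n) : Prop :=
  forall x, X x -> differentiable h x /\ forall v, 'd h x v = dotv (gh x) v.

Definition bregman (Phi : 'rV[R]_n -> R) (gPhi : 'rV[R]_n -> 'rV[R]_n)
  (x y : 'rV[R]_n) : R := Phi x - Phi y - dotv (gPhi y) (x - y).

Definition clip (lam : R) (g : 'rV[R]_n) : 'rV[R]_n :=
  Num.min 1 (lam / enorm g) *: g.

End Defs.

Definition comm_instant (P s : nat) : bool := (1 < s)%N && (P %| s.-1)%N.

Definition tau (P t : nat) : nat :=
  if (1 + P < t)%N then (1 + ((t.-1) %/ P) * P)%N else 1%N.

Section Steps.
Context {R : realType}.
Variables (G kappa mu gamma : R).

Definition alpha (t : nat) : R :=
  (((1 + ln t%:R) `^ gamma) * (t%:R `^ (kappa - mu)))^-1 *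
  Num.min ((t%:R `^ mu)^-1) ((2 * G)^-1).

Definition lambda (t : nat) : R := Num.max (t%:R `^ mu) (2 * G).

Definition sum_from1 (u : nat -> R) : R := limn (fun N => \sum_(1 <= t < N) u t).

End Steps.

Section Prob.
Context {R : realType} {d : measure_display} {Omega : measurableType d}.

(* Y is (a version of) the conditional expectation of X given the
   sigma-algebra F (F a sub-sigma-algebra of the measurable sets):
   X integrable, Y F-measurable and integrable, and the defining identity. *)
Definition is_cond_exp (P : probability Omega R) (F : set (set Omega))
  (X Y : Omega -> R) : Prop :=
  [/\ P.-integrable setT (EFin \o X),
      (forall B : set R, measurable B -> F (Y @^-1` B)),
      P.-integrable setT (EFin \o Y) &
      forall A, F A -> (\int[P]_(w in A) (X w)%:E = \int[P]_(w in A) (Y w)%:E)%E].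

Definition gen_filtration {n m : nat} (g : 'I_m -> nat -> Omega -> 'rV[R]_n)
  (t : nat) : set (set Omega) :=
  <<s [set A | exists (j : 'I_m) (s : nat) (k : 'I_n) (B : set R),
          [/\ (1 <= s <= t)%N, measurable B &
              A = (fun w => g j s w ord0 k) @^-1` B]] >>.

End Prob.

(* Main.v *)
Require Import Defs.
From HB Require Import structures.
From mathcomp Require Import all_boot all_order all_algebra.
From mathcomp Require Import all_classical all_reals all_analysis.
From mathcomp Require Import measurable_realfun ring lra.
Set Implicit Arguments. Unset Strict Implicit. Unset Printing Implicit Defensive.
Import Order.TTheory GRing.Theory Num.Theory.
Import numFieldNormedType.Exports.
Local Open Scope classical_set_scope.
Local Open Scope ring_scope.

(** Write [a_t = al t * la t], so that [a_1 = 1] and [a_t <= 1] is decreasing, and let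
    [D_t] be the sum over the agents of the Bregman divergences from [xstar] to their
    iterates.  The three-point inequality of mirror descent, (A3) at the communication
    instants and the drift bound [a_t] of a single step give
    [al t * gap_t + D_(t+1) <= D_t + (summable) + noise_t],
    where [noise_t] is linear in the clipped gradient errors paired with [x - xstar].

    As the domain may be unbounded, put [M = m (R1 + 10 A)] and let [W_t] be the sum of
    the terms [noise_s / (6 m M)], [s <= t], in which an iterate at distance more than
    [2 M] from [xstar] contributes nothing, and which is frozen once it reaches the level
    [K = ln (1 / delta) + S].  The increments are at most [1 / 2] in absolute value, so
    [exp z <= 1 + z + 2 z^2] applies; replacing the clipped error by the raw error (whose
    conditional mean vanishes) costs only [p]-th moments of the raw error, with no need
    for the conditional mean of the clipped gradient.  Hence [E (exp W_t)] stays below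
    [exp S], and Markov's inequality for the frozen process bounds by [delta] the
    probability that [W] ever reaches [K].  Off this event, induction on [t] gives
    [D_t <= M^2], so that nothing was ever truncated, and the recursion sums to the claim. *)

(** * Euclidean inner product and norm on row vectors *)

Section Euclid.
Context {R : realType} {n : nat}.
Implicit Types (x y z v : 'rV[R]_n) (a : R).

Lemma dotvC x y : dotv x y = dotv y x.
Proof. by apply: eq_bigr => k _; rewrite mulrC. Qed.

Lemma dotvDl x y z : dotv (x + y) z = dotv x z + dotv y z.
Proof. by rewrite -big_split; apply: eq_bigr => k _; rewrite mxE mulrDl. Qed.

Lemma dotvZl a x z : dotv (a *: x) z = a * dotv x z.
Proof. by rewrite mulr_sumr; apply: eq_bigr => k _; rewrite mxE mulrA. Qed.

Lemma dotvNl x z : dotv (- x) z = - dotv x z.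
Proof. by rewrite -scaleN1r dotvZl mulN1r. Qed.

Lemma dotvBl x y z : dotv (x - y) z = dotv x z - dotv y z.
Proof. by rewrite dotvDl dotvNl. Qed.

Lemma dotvDr x y z : dotv z (x + y) = dotv z x + dotv z y.
Proof. by rewrite !(dotvC z) dotvDl. Qed.

Lemma dotvZr a x z : dotv z (a *: x) = a * dotv z x.
Proof. by rewrite !(dotvC z) dotvZl. Qed.

Lemma dotvNr x z : dotv z (- x) = - dotv z x.
Proof. by rewrite !(dotvC z) dotvNl. Qed.

Lemma dotvBr x y z : dotv z (x - y) = dotv z x - dotv z y.
Proof. by rewrite !(dotvC z) dotvBl. Qed.

Definition dotvE := (dotvDl, dotvDr, dotvBl, dotvBr, dotvNl, dotvNr, dotvZl, dotvZr).

Lemma dotv_ge0 x : 0 <= dotv x x.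
Proof. by apply: sumr_ge0 => k _; rewrite -expr2 sqr_ge0. Qed.

Lemma enorm_ge0 x : 0 <= enorm x.
Proof. exact: sqrtr_ge0. Qed.

Lemma enorm_sqr x : enorm x ^+ 2 = dotv x x.
Proof. by rewrite sqr_sqrtr ?dotv_ge0. Qed.

Lemma enorm_eq0 x : enorm x = 0 -> x = 0.
Proof.
move=> x0; have := enorm_sqr x; rewrite x0 expr0n /= => /esym/eqP.
rewrite psumr_eq0; last by move=> k _; rewrite -expr2 sqr_ge0.
move=> /allP h; apply/rowP => k; rewrite mxE.
by have := h k (mem_index_enum _); rewrite -expr2 sqrf_eq0 => /eqP.
Qed.

Lemma enorm0 : enorm (0 : 'rV[R]_n) = 0.
Proof.
by rewrite /enorm /dotv big1 ?sqrtr0// => k _; rewrite mxE mul0r.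
Qed.

Lemma enormZ a x : enorm (a *: x) = `|a| * enorm x.
Proof.
by rewrite /enorm dotvZl dotvZr mulrA -expr2 sqrtrM ?sqr_ge0// sqrtr_sqr.
Qed.

Lemma enormN x : enorm (- x) = enorm x.
Proof. by rewrite -scaleN1r enormZ normrN normr1 mul1r. Qed.

Lemma enorm_distC x y : enorm (x - y) = enorm (y - x).
Proof. by rewrite -enormN opprB. Qed.

(** Cauchy-Schwarz, by expanding the square of [enorm y *: x - enorm x *: y] and cancelling
    [enorm x * enorm y]; this cancellation is why zero vectors are split off first. *)
Lemma dotv_le x y : dotv x y <= enorm x * enorm y.
Proof.
have [/enorm_eq0 ->|x0] := eqVneq (enorm x) 0.
  by rewrite enorm0 mul0r -(scale0r x) dotvZl mul0r.
have [/enorm_eq0 ->|y0] := eqVneq (enorm y) 0.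
  by rewrite enorm0 mulr0 -(scale0r x) dotvZr mul0r.
have xy0 : 0 < enorm x * enorm y.
  by rewrite mulr_gt0// lt0r ?x0 ?y0 enorm_ge0.
have := dotv_ge0 (enorm y *: x - enorm x *: y).
rewrite !dotvE -!enorm_sqr (dotvC y x) => h.
rewrite -(ler_pM2l xy0); nra.
Qed.

Lemma dotv_abs_le x y : `|dotv x y| <= enorm x * enorm y.
Proof.
by rewrite ler_norml dotv_le andbT lerNl -dotvNl -(enormN x) dotv_le.
Qed.

Lemma enorm_triangle x y : enorm (x + y) <= enorm x + enorm y.
Proof.
rewrite -(@ler_pXn2r _ 2) ?nnegrE ?addr_ge0 ?enorm_ge0//.
rewrite sqrrD !enorm_sqr !dotvE (dotvC y x).
have := dotv_le x y; nra.
Qed.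

End Euclid.

(** * Convexity, gradients and Jensen's inequality *)

Section Convexity.
Context {R : realType} {n : nat}.
Implicit Types (x y z v : 'rV[R]_n) (X : set 'rV[R]_n) (h : 'rV[R]_n -> R).

Lemma convex_setP X x y (a : R) : convex_set X -> X x -> X y -> 0 <= a <= 1 ->
  X (a *: x + (1 - a) *: y).
Proof.
move=> cX Xx Xy /andP[a0 a1].
pose p : {i01 R} := Itv01 a0 a1.
by have := cX x y p (mem_set Xx) (mem_set Xy); rewrite inE.
Qed.

Lemma convex_set_step X x z (a : R) : convex_set X -> X x -> X z ->
  0 <= a <= 1 -> X (x + a *: (z - x)).
Proof.
move=> cX Xx Xz a01.
have -> : x + a *: (z - x) = a *: z + (1 - a) *: x.
  by apply/rowP => k; rewrite !mxE; ring.
exact: convex_setP.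
Qed.

(** Averaging a head with a nonempty tail is a two-point convex combination, which lets two-point
    convexity pass to lists by induction. *)
Lemma average_cons (I : Type) (F : I -> 'rV[R]_n) i (s : seq I) : (0 < size s)%N ->
  let a := (size s).+1%:R^-1 : R in
  (size (i :: s))%:R^-1 *: \sum_(j <- i :: s) F j =
    a *: F i + (1 - a) *: ((size s)%:R^-1 *: \sum_(j <- s) F j).
Proof.
move=> s0 a; rewrite big_cons scalerDr scalerA; congr (_ + _ *: _).
rewrite /a -natr1; field.
by rewrite natr1 !pnatr_eq0 -lt0n s0.
Qed.

Lemma convex_set_average X (I : Type) (F : I -> 'rV[R]_n) (s : seq I) :
  convex_set X -> (forall i, X (F i)) -> (0 < size s)%N ->
  X ((size s)%:R^-1 *: \sum_(j <- s) F j).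
Proof.
move=> cX XF; elim: s => // i [_ _|j s IH _].
  by rewrite big_seq1 /= invr1 scale1r.
rewrite average_cons//; apply: convex_setP => //; first exact: IH.
by rewrite invr_ge0 ler0n/= invf_le1 ?ler1n.
Qed.

Lemma jensen_average X h (I : Type) (F : I -> 'rV[R]_n) (s : seq I) :
  convex_set X -> convex_on X h -> (forall i, X (F i)) -> (0 < size s)%N ->
  h ((size s)%:R^-1 *: \sum_(j <- s) F j) <= (size s)%:R^-1 * \sum_(j <- s) h (F j).
Proof.
move=> cX ch XF; elim: s => // i [_ _|j s IH _].
  by rewrite !big_seq1 /= invr1 scale1r mul1r.
have a01 : 0 <= ((size (j :: s)).+1%:R^-1 : R) <= 1.
  by rewrite invr_ge0 ler0n/= invf_le1 ?ler1n.
rewrite average_cons//; apply: le_trans (ch _ _ _ (XF i) _ a01) _.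
  exact: convex_set_average.
set a := _^-1 in a01 *.
have e : (1 - a) * (size (j :: s))%:R^-1 = a.
  by rewrite /a -natr1; field; rewrite natr1 !pnatr_eq0.
have h1 : (1 - a) * h ((size (j :: s))%:R^-1 *: \sum_(k <- j :: s) F k) <=
    (1 - a) * ((size (j :: s))%:R^-1 * \sum_(k <- j :: s) h (F k)).
  by rewrite ler_wpM2l ?IH// subr_ge0; case/andP: a01.
apply: le_trans (lerD (lexx _) h1) _.
by rewrite [in leRHS]big_cons mulrDr mulrA e.
Qed.

Lemma cvg_harmonic_dnbhs : (@harmonic R) @ \oo --> (0 : R)^'.
Proof.
move=> A; rewrite /dnbhs /within /= => /(@cvg_harmonic R) hA.
suff : \forall N \near \oo, A (harmonic N) by [].
have {}hA : \forall N \near \oo, (harmonic N : R) != 0 -> A (harmonic N) by [].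
by apply: filterS hA => N; apply; rewrite gt_eqF// harmonic_gt0.
Qed.

(** The steps [1 / (N + 1)] form a sequence, as pointwise limits of measurable functions require,
    and lie in [[0, 1]], so that moving towards a point of a convex set never leaves it. *)
Lemma directional_limit h x v : differentiable h x ->
  (fun N : nat => N.+1%:R * (h (x + N.+1%:R^-1 *: v) - h x)) @ \oo --> 'd h x v.
Proof.
move=> dh; have dv := @diff_derivable _ _ _ h x v dh.
have hl : (fun t : R => t^-1 *: ((h \o shift x) (t *: v) - h x)) @ 0^' --> 'd h x v.
  by rewrite -deriveE//; exact: dv.
have := cvg_comp _ _ cvg_harmonic_dnbhs hl.
apply: cvg_trans; apply: near_eq_cvg; apply: nearW => N /=.
by rewrite invrK (addrC x).
Qed.

(** By convexity every difference quotient along the segment from [x] to [z] is at most [h z - h x];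
    the gradient term is their limit. *)
Lemma convex_gradient X h gh x z : convex_set X -> convex_on X h ->
  gradient_on X h gh -> X x -> X z -> dotv (gh x) (z - x) <= h z - h x.
Proof.
move=> cX ch gr Xx Xz; have [dh <-] := gr x Xx.
have hl := @directional_limit h x (z - x) dh.
move/cvg_lim: (hl) => <-//; apply: limr_le; first by apply: cvgP hl.
apply: nearW => N.
have a01 : 0 <= (N.+1%:R^-1 : R) <= 1.
  by rewrite invr_ge0 ler0n/= invf_le1 ?ler1n.
have := ch z x _ Xz Xx a01.
have -> : x + N.+1%:R^-1 *: (z - x) = N.+1%:R^-1 *: z + (1 - N.+1%:R^-1) *: x.
  by apply/rowP => k; rewrite !mxE; ring.
set u := h (_ + _) => hu.
rewrite mulrC -ler_pdivlMr ?ltr0n//.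
by move: hu; set a := _^-1; lra.
Qed.

End Convexity.

(** * One mirror descent step *)

Section Mirror.
Context {R : realType} {n : nat} (X : set 'rV[R]_n) (Phi : 'rV[R]_n -> R)
  (gPhi : 'rV[R]_n -> 'rV[R]_n).
Hypothesis cX : convex_set X.
Hypothesis gr : gradient_on X Phi gPhi.
Hypothesis sc : forall u v, X u -> X v ->
     dotv (gPhi v) (u - v) + 2^-1 * enorm (u - v) ^+ 2 <= Phi u - Phi v.

Lemma bregman_ge u v : X u -> X v -> 2^-1 * enorm (u - v) ^+ 2 <= bregman Phi gPhi u v.
Proof. by move=> Xu Xv; have := sc Xu Xv; rewrite /bregman; lra. Qed.

Lemma three_point x y z : bregman Phi gPhi z x - bregman Phi gPhi z y - bregman Phi gPhi y x
  = dotv (gPhi y - gPhi x) (z - y).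
Proof. rewrite /bregman !dotvE; ring. Qed.

(** The variational inequality of a constrained minimizer: [y] is compared with
    [y + (z - y) / (N + 1)], which lies in [X]; the inequality is scaled by [a (N + 1)] and [N]
    tends to infinity. *)
Lemma mirror_optimality (a : R) (c x y z : 'rV[R]_n) : 0 < a -> X y ->
  (forall z, X z -> dotv c y + a^-1 * bregman Phi gPhi y x
     <= dotv c z + a^-1 * bregman Phi gPhi z x) -> X z ->
  0 <= dotv (a *: c + gPhi y - gPhi x) (z - y).
Proof.
move=> a0 Xy ymin Xz; have [dPhi dE] := gr Xy.
have hl := @directional_limit _ _ Phi y (z - y) dPhi.
have hl2 : (fun N : nat => a * dotv c (z - y) + (N.+1%:R *
    (Phi (y + N.+1%:R^-1 *: (z - y)) - Phi y)) - dotv (gPhi x) (z - y)) @ \oo -->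
    a * dotv c (z - y) + 'd Phi y (z - y) - dotv (gPhi x) (z - y).
  by apply: cvgB; [apply: cvgD; [exact: cvg_cst|exact: hl]|exact: cvg_cst].
have -> : dotv (a *: c + gPhi y - gPhi x) (z - y) =
    a * dotv c (z - y) + 'd Phi y (z - y) - dotv (gPhi x) (z - y).
  by rewrite dE [LHS]dotvBl dotvDl dotvZl.
move/cvg_lim: (hl2) => <-//; apply: limr_ge; first by apply: cvgP hl2.
apply: nearW => N.
have N0 : 0 < (N.+1%:R : R) by rewrite ltr0n.
have a01 : 0 <= (N.+1%:R^-1 : R) <= 1.
  by rewrite invr_ge0 ler0n/= invf_le1 ?ler1n.
have := ymin _ (convex_set_step cX Xy Xz a01).
set u := y + _.
rewrite -(ler_pM2l a0) !mulrDr !mulrA divff ?gt_eqF// !mul1r -(ler_pM2l N0).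
have uy : u - y = N.+1%:R^-1 *: (z - y) by rewrite /u addrC addKr.
rewrite /bregman -subr_ge0.
set L := (X in 0 <= X -> _); move=> L0.
have zy : z - y = N.+1%:R *: (u - y).
  by rewrite uy scalerA divff ?gt_eqF// scale1r.
suff : a * dotv c (z - y) + N.+1%:R * (Phi u - Phi y) - dotv (gPhi x) (z - y) = L.
  by move=> e /=; rewrite -/u -mulrDr e.
by rewrite zy /L !dotvE; ring.
Qed.

Let optimality_split (a : R) (c u v w : 'rV[R]_n) :
  dotv (a *: c + u - v) w = a * dotv c w + dotv (u - v) w.
Proof. by rewrite -addrA [LHS]dotvDl dotvZl. Qed.

(** Young's inequality bounds [a * lam * e] by [(a * lam)^2 / 2 + e^2 / 2] with [e = enorm (y - x)],
    and the divergence of [y] from [x], at least [e^2 / 2] by strong convexity, pays for the second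
    half. *)
Lemma mirror_step (a lam : R) (c x y z : 'rV[R]_n) : 0 < a -> X x -> X y -> X z ->
  enorm c <= lam ->
  0 <= dotv (a *: c + gPhi y - gPhi x) (z - y) ->
  a * dotv c (x - z) <= bregman Phi gPhi z x - bregman Phi gPhi z y
    + 2^-1 * (a * lam) ^+ 2.
Proof.
move=> a0 Xx Xy Xz cl opt.
have -> : bregman Phi gPhi z x - bregman Phi gPhi z y =
  dotv (gPhi y - gPhi x) (z - y) + bregman Phi gPhi y x.
  by rewrite -(three_point x y z) subrK.
have := bregman_ge Xy Xx.
set e := enorm (y - x); set D := bregman _ _ _ _ => De.
move: opt; rewrite optimality_split.
set q := dotv (gPhi _ - _) _.
have -> : dotv c (x - z) = - dotv c (z - y) + dotv c (x - y) by rewrite !dotvE; ring.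
have e0 : 0 <= e by apply: enorm_ge0.
have : dotv c (x - y) <= lam * e.
  apply: le_trans (dotv_le _ _) _; rewrite enorm_distC; exact: ler_wpM2r.
set r := dotv c (x - y) => hr q0.
have : a * r <= a * (lam * e) by rewrite ler_pM2l.
have := sqr_ge0 (a * lam - e); lra.
Qed.

(** Testing optimality at [x] bounds the symmetrized divergence by [a * lam * e], while strong
    convexity in both directions bounds it below by [e^2]. *)
Lemma mirror_move (a lam : R) (c x y : 'rV[R]_n) : 0 < a -> X x -> X y ->
  enorm c <= lam ->
  0 <= dotv (a *: c + gPhi y - gPhi x) (x - y) ->
  enorm (y - x) <= a * lam.
Proof.
move=> a0 Xx Xy cl opt.
have := bregman_ge Xy Xx; have := bregman_ge Xx Xy.
have := three_point x y x.
move: opt; rewrite optimality_split.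
set q := dotv (gPhi _ - _) _ => q0 tp h1 h2.
have : dotv c (x - y) <= lam * enorm (y - x).
  apply: le_trans (dotv_le _ _) _; rewrite enorm_distC; apply: ler_wpM2r => //; exact: enorm_ge0.
have b0 : bregman Phi gPhi x x = 0 by rewrite /bregman dotvBr !subrr.
move: h1; rewrite enorm_distC; move: h2 tp.
set e := enorm _ => h2 tp h1 hr.
have : a * dotv c (x - y) <= a * (lam * e) by rewrite ler_pM2l.
have e0 : 0 <= e by apply: enorm_ge0.
have al : 0 <= a * lam by rewrite mulr_ge0 ?(ltW a0)// (le_trans _ cl)// enorm_ge0.
move=> hq; rewrite leNgt; apply/negP => lt_e.
nra.
Qed.

(** Quadratic growth of the step objective, stripped of its terms constant in the minimization
    variable; this is the growth that [argmin_measurable] asks for. *)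
Lemma mirror_strong (a : R) (c x y z : 'rV[R]_n) : 0 < a -> X y -> X z ->
  0 <= dotv (a *: c + gPhi y - gPhi x) (z - y) ->
  a * dotv c y + Phi y - dotv (gPhi x) y + 2^-1 * enorm (z - y) ^+ 2
    <= a * dotv c z + Phi z - dotv (gPhi x) z.
Proof.
move=> a0 Xy Xz; have := sc Xz Xy; rewrite !dotvE; lra.
Qed.

End Mirror.

(** * Pointwise estimates for gradient clipping *)

Section Clipping.
Context {R : realType} {n : nat}.
Implicit Types (g v : 'rV[R]_n) (lam p r : R).

(** After multiplication by [1 - z > 0] the left side is at most [1], since [1 - z <= expR (- z)],
    and the right side is [1 + z^2 (1 - 2 z) >= 1]. *)
Lemma expR_le_quadratic (z : R) : z <= 2^-1 -> expR z <= 1 + z + 2 * z ^+ 2.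
Proof.
move=> z2; have h := expR_ge1Dx (- z).
have e0 := expR_gt0 z; have ee : expR z * expR (- z) = 1 by rewrite -expRD subrr expR0.
rewrite -(@ler_pM2r _ (1 - z)); last by lra.
apply: (@le_trans _ _ 1); first by rewrite -[leRHS]ee ler_pM2l.
have := sqr_ge0 z; nra.
Qed.

Lemma clip_inside lam g : enorm g <= lam -> clip lam g = g.
Proof.
(* At [g = 0] the quotient [lam / 0] is [0] by convention, so the clipping factor is [0] instead of
   [1]; on the zero vector both agree. *)
move=> gl; have [/enorm_eq0 ->|g0] := eqVneq (enorm g) 0; first by rewrite /clip scaler0.
have gp : 0 < enorm g by rewrite lt0r g0 enorm_ge0.
by rewrite /clip min_l ?scale1r// ler_pdivlMr// mul1r.
Qed.

Lemma clip_outside lam g : 0 < lam -> lam < enorm g ->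
  clip lam g = (lam / enorm g) *: g.
Proof.
move=> l0 gl; rewrite /clip min_r// ler_pdivrMr ?mul1r ?ltW//.
exact: lt_trans gl.
Qed.

Lemma enorm_clip lam g : 0 < lam -> enorm (clip lam g) <= lam.
Proof.
move=> l0; have [gl|gl] := leP (enorm g) lam; first by rewrite clip_inside.
have gp := lt_trans l0 gl.
by rewrite clip_outside// enormZ ger0_norm ?divr_ge0 ?(ltW l0) ?(ltW gp)// divfK ?gt_eqF.
Qed.

(** The bias vanishes unless [enorm g > lam]. Then [r = enorm (g - v)] is at least [lam / 2] and the
    bias is at most [r = r^p r^(1-p)]; as [1 - p < 0], the last factor is at most
    [2^(p-1) lam^(1-p)]. *)
Lemma clip_bias lam p g v : 0 < lam -> enorm v <= lam / 2 -> 1 < p <= 2 ->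
  enorm (clip lam g - g) <= 2 * enorm (g - v) `^ p * lam `^ (1 - p).
Proof.
move=> l0 vl /andP[p1 p2]; set r := enorm (g - v).
have [gl|gl] := leP (enorm g) lam.
  by rewrite clip_inside// subrr enorm0 !mulr_ge0 ?powR_ge0.
have gp := lt_trans l0 gl.
have gr : enorm g <= r + lam / 2.
  by rewrite -{1}(subrK v g) (le_trans (enorm_triangle _ _))// lerD2l.
have r0 : lam / 2 <= r by lra.
have -> : enorm (clip lam g - g) = enorm g - lam.
  rewrite clip_outside//.
    have -> : (lam / enorm g) *: g - g = (lam / enorm g - 1) *: g by rewrite scalerBl scale1r.
    rewrite enormZ ler0_norm.
      by field; rewrite gt_eqF.
    by rewrite subr_le0 ler_pdivrMr ?mul1r ?ltW.
apply: (@le_trans _ _ r); first by lra.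
have rp : 0 <= r by exact: enorm_ge0.
have h2 : (2:R) `^ p <= 4.
  have -> : (4 : R) = 2 `^ 2 by rewrite powR_mulrn//; lra.
  by rewrite ler_powR//; lra.
have h : 2 * r * lam `^ p <= 2 `^ p * r `^ p * lam.
  rewrite -powRM// -(@mulr_powRB1 _ lam p) ?(ltW l0)//; last by lra.
  rewrite -(@mulr_powRB1 _ (2 * r) p); [|lra|lra].
  have := @ge0_ler_powR R (p - 1) _ lam (2 * r).
  rewrite !nnegrE => /(_ _ _ _ _) h.
  have {h} : lam `^ (p - 1) <= (2 * r) `^ (p - 1) by apply: h; lra.
  set L := _ `^ _; set M := _ `^ _ => LM.
  have : (2 * r * lam) * L <= (2 * r * lam) * M.
    by rewrite ler_wpM2l// !mulr_ge0// ltW.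
  lra.
have h3 : 2 `^ p * (r `^ p * lam) <= 4 * (r `^ p * lam).
  by rewrite ler_wpM2r// mulr_ge0 ?powR_ge0// ltW.
have lp : 0 < lam `^ p by exact: powR_gt0.
rewrite powRB ?(gt_eqF l0) ?implybT// powRr1 ?(ltW l0)// mulrA ler_pdivlMr//.
move: h3; rewrite mulrA; lra.
Qed.

Lemma clip_dist lam g v : 0 < lam -> enorm v <= lam / 2 ->
  enorm (clip lam g - v) <= 3 / 2 * lam.
Proof.
move=> l0 vl; apply: le_trans (enorm_triangle _ _) _.
by rewrite enormN; have := enorm_clip g l0; lra.
Qed.

(** Without clipping, [r^2 = r^p r^(2-p)] and [r <= 3/2 lam]. With clipping, [lam <= 2 r] trades
    [lam^p] for [4 r^p] in the bound [(3/2 lam)^2], which produces the [9]. *)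
Lemma clip_second_moment lam p g v : 0 < lam -> enorm v <= lam / 2 -> 1 < p <= 2 ->
  enorm (clip lam g - v) ^+ 2 <= 9 * enorm (g - v) `^ p * lam `^ (2 - p).
Proof.
move=> l0 vl /andP[p1 p2]; set r := enorm (g - v).
have r0 : 0 <= r by exact: enorm_ge0.
have dl := clip_dist g l0 vl.
have [gl|gl] := leP (enorm g) lam.
  move: dl; rewrite clip_inside// -/r => dl.
  have [->|rn0] := eqVneq r 0; first by rewrite expr0n/= !mulr_ge0 ?powR_ge0.
  have -> : r ^+ 2 = r `^ p * r `^ (2 - p).
    by rewrite -powRD ?rn0 ?implybT// addrC subrK -powR_mulrn.
  have : r `^ (2 - p) <= (3 / 2 * lam) `^ (2 - p).
    by rewrite ge0_ler_powR ?nnegrE//; lra.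
  rewrite powRM; [|lra|lra].
  have : (3 / 2 : R) `^ (2 - p) <= 3 / 2.
    rewrite -[leRHS]powRr1; last by lra.
    by rewrite ler_powR//; lra.
  set A := _ `^ (2 - p); set B := lam `^ _ => hA hr.
  have B0 : 0 <= B by exact: powR_ge0.
  have P0 : 0 <= r `^ p by exact: powR_ge0.
  have : r `^ (2 - p) <= 9 * B.
    by apply: le_trans hr _; rewrite ler_wpM2r//; lra.
  move=> hB; have := ler_wpM2l P0 hB; lra.
have gr : enorm g <= r + lam / 2.
  by rewrite -{1}(subrK v g) (le_trans (enorm_triangle _ _))// lerD2l.
have -> : lam `^ (2 - p) = lam ^+ 2 / lam `^ p.
  by have := @powRB R lam 2 p; rewrite (gt_eqF l0) implybT powR_mulrn ?(ltW l0)// => ->.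
have lp : 0 < lam `^ p by exact: powR_gt0.
rewrite mulrA ler_pdivlMr//.
have h : lam `^ p <= 4 * r `^ p.
  apply: (@le_trans _ _ ((2 * r) `^ p)).
    by rewrite ge0_ler_powR ?nnegrE//; lra.
  rewrite powRM//.
  rewrite ler_wpM2r ?powR_ge0//.
  have -> : (4 : R) = 2 `^ 2 by rewrite powR_mulrn//; lra.
  by rewrite ler_powR//; lra.
have h2 : enorm (clip lam g - v) ^+ 2 <= 9 / 4 * lam ^+ 2.
  have -> : 9 / 4 * lam ^+ 2 = (3 / 2 * lam) ^+ 2 by field.
  by rewrite ler_pXn2r ?nnegrE ?enorm_ge0//; lra.
apply: le_trans (ler_pM _ (ltW lp) h2 h) _; first exact: sqr_ge0.
by rewrite le_eqVlt; apply/orP; left; apply/eqP; field.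
Qed.

End Clipping.

(** * Series with nonnegative terms; a Bertrand series *)

Section NonnegSeries.
Context {R : realType}.
Implicit Types (u v : nat -> R).

Definition partial_bound u (B : R) := forall N, \sum_(1 <= t < N) u t <= B.

(** [sum_from1] is a [limn], which takes a default value on divergent sequences. A uniform bound on
    the partial sums, of whatever size, makes it a genuine supremum. *)
Lemma sum_from1_ub u B : (forall t, (0 < t)%N -> 0 <= u t) -> partial_bound u B ->
  forall N, \sum_(1 <= t < N) u t <= sum_from1 u.
Proof.
move=> u0 uB N.
have nd : nondecreasing_seq (fun N => \sum_(1 <= t < N) u t).
  apply/nondecreasing_seqP => k; case: k => [|k]; first by rewrite !big_geq.
  by rewrite [leRHS]big_nat_recr//= lerDl u0.
apply: (nondecreasing_cvgn_le nd).
apply: nondecreasing_is_cvgn => //.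
by exists B => _ [k _ <-]; exact: uB.
Qed.

Lemma sum_from1_ge0 u B : (forall t, (0 < t)%N -> 0 <= u t) -> partial_bound u B ->
  0 <= sum_from1 u.
Proof. by move=> u0 uB; have := sum_from1_ub u0 uB 0; rewrite big_geq. Qed.

Lemma partial_bound_le u v B : (forall t, (0 < t)%N -> u t <= v t) ->
  partial_bound v B -> partial_bound u B.
Proof.
move=> uv vB N; apply: le_trans (vB N); rewrite big_nat_cond [leRHS]big_nat_cond.
by apply: ler_sum => t /andP[/andP[t0 _] _]; exact: uv.
Qed.

(** Prepared for [C1], where [tau] lags behind by up to one period: a late term at [t] is compared
    with the series one period earlier, an early one with [1]. *)
Lemma partial_bound_shift u B (k : nat) :
  (forall t, (0 < t)%N -> 0 <= u t) -> partial_bound u B ->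
  partial_bound (fun t => if (t <= k)%N then 1 else u (t - k)%N) (k%:R + B).
Proof.
move=> u0 uB N.
have B0 : 0 <= B by have := uB 0; rewrite big_geq.
have [Nk|kN] := leqP N k.+1.
  rewrite (eq_big_nat _ _ (F2 := fun=> 1)); last first.
    by move=> t /andP[_ tN]; rewrite -ltnS (leq_trans tN).
  by rewrite sumr_const_nat ler_wpDr// ler_nat leq_subLR add1n.
rewrite (big_cat_nat (n := k.+1))//=; last exact: ltnW.
rewrite lerD//.
  rewrite (eq_big_nat _ _ (F2 := fun=> 1)).
    by rewrite sumr_const_nat subn1.
  by move=> t /andP[_]; rewrite ltnS => ->.
apply: le_trans (uB (N - k)%N).
rewrite -{1}(addn1 k) addnC big_addn.
rewrite le_eqVlt; apply/orP; left; apply/eqP; apply: eq_big_nat => t /andP[t0 _].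
by rewrite -{2}(add0n k) leq_add2r leqNgt t0 addnK.
Qed.

(** Bertrand's series, from which the bounds on all of [C1] to [C5] are obtained. *)
Definition log_term (gamma : R) (t : nat) : R :=
  ((1 + ln t%:R) `^ gamma * t%:R)^-1.

Lemma ln_nat_ge0 (t : nat) : 0 <= ln (t%:R : R).
Proof. by case: t => [|t]; [rewrite ln0//|rewrite ln_ge0// ler1n]. Qed.

Lemma log_term_ge0 gamma t : 0 <= log_term gamma t.
Proof. by rewrite invr_ge0 mulr_ge0 ?powR_ge0. Qed.

(** A discrete integral test: up to the factor [1 - gamma], [(1 + ln t)^(1 - gamma)] is an
    antiderivative of the term. With [a], [b] the values of [1 + ln] at [t] and [t + 1], it combines
    [b - a >= 1 / (t + 1)] with the tangent bound [(a / b)^(1 - gamma) >= 1 + (gamma - 1) (1 - a /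
    b)]. *)
Lemma log_term_telescope (gamma : R) (t : nat) : 1 < gamma -> (0 < t)%N ->
  (gamma - 1) * log_term gamma t.+1 <=
  (1 + ln t%:R) `^ (1 - gamma) - (1 + ln t.+1%:R) `^ (1 - gamma).
Proof.
move=> g1 t0; set a := 1 + ln t%:R; set b := 1 + ln t.+1%:R.
have a0 : 0 < a by rewrite ltr_pwDl// ln_nat_ge0.
have b0 : 0 < b by rewrite ltr_pwDl// ln_nat_ge0.
have tp : 0 < t%:R :> R by rewrite ltr0n.
have sp : 0 < t.+1%:R :> R by rewrite ltr0n.
have ab : t.+1%:R^-1 <= b - a.
  have e : b - a = - ln (t%:R / t.+1%:R).
    by rewrite /a /b lnM ?posrE ?invr_gt0// lnV ?posrE//; ring.
  have h := @le_ln1Dx R (- t.+1%:R^-1).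
  rewrite e lerNr.
  have -> : t%:R / t.+1%:R = 1 + - t.+1%:R^-1 :> R.
    by rewrite -natr1; field; rewrite natr1 pnatr_eq0.
  by apply: h; rewrite ltrN2 invf_lt1// ltr1n.
have c0 : 0 < a / b by rewrite divr_gt0.
have h1 : 1 + (gamma - 1) * (1 - a / b) <= (a / b) `^ (1 - gamma).
  rewrite /powR gt_eqF//.
  have := expR_ge1Dx ((1 - gamma) * ln (a / b)).
  have : ln (a / b) <= a / b - 1.
    have {1}-> : a / b = 1 + (a / b - 1) by ring.
    by apply: le_ln1Dx; lra.
  nra.
have ea : a `^ (1 - gamma) = b `^ (1 - gamma) * (a / b) `^ (1 - gamma).
  by rewrite -powRM ?ltW// mulrCA divff ?mulr1// gt_eqF.
have bg : b `^ (1 - gamma) = b / b `^ gamma.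
  by have := @powRB R b 1 gamma; rewrite (gt_eqF b0) implybT powRr1 ?(ltW b0)// => ->.
have Bp : 0 < b `^ gamma by rewrite powR_gt0.
rewrite ea /log_term -/b.
apply: (@le_trans _ _ (b `^ (1 - gamma) * ((gamma - 1) * (1 - a / b)))); last first.
  have := powR_ge0 b (1 - gamma); nra.
rewrite bg invfM.
have -> : b / b `^ gamma * ((gamma - 1) * (1 - a / b)) =
   (gamma - 1) * ((b `^ gamma)^-1 * (b - a)) by field; rewrite !gt_eqF.
rewrite ler_wpM2l//; first by lra.
by rewrite ler_wpM2l// invr_ge0 ltW.
Qed.

Lemma log_term_bound gamma : 1 < gamma ->
  partial_bound (log_term gamma) (1 + (gamma - 1)^-1).
Proof.
move=> g1.
have g0 : 0 < gamma - 1 by lra.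
have gi : 0 <= (gamma - 1)^-1 by rewrite invr_ge0 ltW.
have l1 : log_term gamma 1 = 1.
  by rewrite /log_term ln1 addr0 powR1 mulr1 invr1.
case => [|[|[|N]]].
- by rewrite big_geq//; lra.
- by rewrite big_geq//; lra.
- by rewrite big_nat1 l1; lra.
rewrite big_nat_recl// l1 lerD2l.
have H k : (gamma - 1) * \sum_(1 <= i < k.+1) log_term gamma i.+1 <=
   1 - (1 + ln k.+1%:R) `^ (1 - gamma).
  elim: k => [|k IH]; first by rewrite big_geq// mulr0 ln1 addr0 powR1 subrr.
  rewrite big_nat_recr//= mulrDr.
  have := log_term_telescope g1 (ltn0Sn k); lra.
rewrite -(ler_pM2l g0) divff ?gt_eqF//.
apply: le_trans (H N.+1) _; have := powR_ge0 (1 + ln N.+2%:R : R) (1 - gamma); lra.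
Qed.

End NonnegSeries.

(** * The last communication instant *)

Section Tau.
Variable P : nat.
Hypothesis P0 : (0 < P)%N.

Lemma tau_gt0 t : (0 < tau P t)%N.
Proof. by rewrite /tau; case: ifP. Qed.

Lemma tau_le t : (0 < t)%N -> (tau P t <= t)%N.
Proof.
rewrite /tau; case: ifP => // _; case: t => //= t _.
by rewrite add1n ltnS leq_divM.
Qed.

Lemma tau_ge t : (t <= tau P t + P)%N.
Proof.
rewrite /tau; case: ifP => [|/negbT]; last by rewrite -leqNgt.
case: t => //= t _.
by rewrite add1n addSn ltnS -mulSnr ltnW// ltn_ceil.
Qed.

Lemma comm_instant_dvd k : (0 < k)%N -> comm_instant P (1 + k * P)%N.
Proof. by move=> k0; rewrite /comm_instant add1n /= ltnS muln_gt0 k0 P0 dvdn_mull. Qed.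

(* [t = P.+1] is excluded: it is a communication instant although [tau P P.+1 = 1]. *)
Lemma no_comm_after_tau t s : (tau P t < s <= t)%N -> (t != P.+1)%N -> ~~ comm_instant P s.
Proof.
rewrite /tau /comm_instant; case: ifP => [Pt|/negbT].
  move=> /andP[]; case: s => // s; case: t Pt => //= t Pt; rewrite add1n !ltnS => h1 h2 _.
  apply/negP => /andP[_ /dvdnP[q e]]; move: h1 h2; rewrite e ltn_pmul2r// => h1.
  by rewrite leqNgt -ltn_divLR// h1.
rewrite -leqNgt add1n => h /andP[s1 st] tP; apply/negP => /andP[_ d].
have := dvdn_leq _ d; rewrite -subn1 subn_gt0 s1 => /(_ isT) h2.
have tP' : (t <= P)%N by rewrite -ltnS ltn_neqAle tP.
by have := leq_trans st tP'; rewrite leqNgt -(subnK (ltnW s1)) addn1 ltnS h2.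
Qed.

Lemma tau_small t : (t <= P.+1)%N -> tau P t = 1%N.
Proof. by rewrite /tau add1n ltnNge => ->. Qed.

Lemma tau_large t : (P.+1 < t)%N -> comm_instant P (tau P t).
Proof.
move=> h; rewrite /tau add1n h; apply: comm_instant_dvd.
by rewrite divn_gt0// -ltnS (ltn_predK h) ltnW.
Qed.

End Tau.

(** * Step sizes and summability of the constants *)

Section StepSizes.
Context {R : realType} (G kappa mu gamma p : R) (P : nat).
Hypotheses (G0 : 0 < G) (p12 : 1 < p <= 2)
  (mu01 : 0 < mu < 1) (hkappa : Num.max (mu + 2^-1) (1 - mu * (p - 1)) <= kappa)
  (gamma1 : 1 < gamma) (P0 : (0 < P)%N).

Let al := alpha G kappa mu gamma.
Let la := lambda G mu.
Definition step_bound (t : nat) : R :=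
  ((1 + ln t%:R) `^ gamma * t%:R `^ (kappa - mu))^-1.

Let kmu : mu + 2^-1 <= kappa /\ 1 - mu * (p - 1) <= kappa.
Proof. by move: hkappa; rewrite ge_max => /andP. Qed.

Let mu0 : 0 < mu. Proof. by case/andP: mu01. Qed.
Let p1 : 1 < p. Proof. by case/andP: p12. Qed.

Ltac step_lra := have := G0; have := mu0; have := p1; have := gamma1; have [] := kmu; lra.

Lemma lambda_ge2G t : 2 * G <= la t.
Proof. by rewrite /la /lambda le_max lexx orbT. Qed.

Lemma lambda_gt0 t : 0 < la t.
Proof. by apply: lt_le_trans (lambda_ge2G t); rewrite mulr_gt0. Qed.

Lemma lambda_ge_pow t : t%:R `^ mu <= la t.
Proof. by rewrite /la /lambda le_max lexx. Qed.

Lemma lambda_ge1 t : (0 < t)%N -> 1 <= la t.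
Proof.
move=> t0; apply: le_trans (lambda_ge_pow t).
rewrite -[leLHS](powRr0 (t%:R : R)); apply: ler_powR; [by rewrite ler1n|exact: ltW].
Qed.

Let denominator_gt0 t : (0 < t)%N ->
  0 < (1 + ln t%:R) `^ gamma * t%:R `^ (kappa - mu).
Proof.
move=> t0; rewrite mulr_gt0// powR_gt0// ?ltr0n//.
by rewrite ltr_pwDl// ln_nat_ge0.
Qed.

Let denominator_le s t : (0 < s)%N -> (s <= t)%N ->
  (1 + ln s%:R) `^ gamma * s%:R `^ (kappa - mu) <=
  (1 + ln t%:R) `^ gamma * t%:R `^ (kappa - mu).
Proof.
move=> s0 st; have t0 := leq_trans s0 st.
have l : ln (s%:R : R) <= ln t%:R by rewrite ler_ln ?posrE ?ltr0n// ler_nat.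
have l0 := @ln_nat_ge0 R s.
have [k1 k2] := kmu.
by rewrite ler_pM ?powR_ge0// ge0_ler_powR ?nnegrE ?ler_nat//; step_lra.
Qed.

Lemma alpha_gt0 t : (0 < t)%N -> 0 < al t.
Proof.
move=> t0; rewrite /al /alpha mulr_gt0 ?invr_gt0 ?denominator_gt0//.
rewrite lt_min !invr_gt0 powR_gt0 ?ltr0n//=; step_lra.
Qed.

Lemma alpha_le s t : (0 < s)%N -> (s <= t)%N -> al t <= al s.
Proof.
move=> s0 st; have t0 := leq_trans s0 st.
rewrite /al /alpha ler_pM ?invr_ge0 ?(ltW (denominator_gt0 _))//.
- by rewrite le_min !invr_ge0 powR_ge0/=; step_lra.
- by rewrite lef_pV2 ?posrE ?denominator_gt0// denominator_le.
rewrite le_min ge_min ge_min lexx orbT andbT lef_pV2 ?posrE ?powR_gt0 ?ltr0n//.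
by rewrite ge0_ler_powR ?nnegrE ?ler_nat//; step_lra.
Qed.

(** The minimum in [alpha] and the maximum in [lambda] are reciprocal, so [G] cancels from the
    product. *)
Lemma alpha_lambda t : (0 < t)%N -> al t * la t = step_bound t.
Proof.
move=> t0; rewrite /al /alpha /la /lambda /step_bound -[RHS]mulr1 -mulrA; congr (_ * _).
have x0 : 0 < t%:R `^ mu :> R by rewrite powR_gt0 ?ltr0n.
have g0 : 0 < 2 * G by step_lra.
have [xg|gx] := leP (t%:R `^ mu) (2 * G).
  by rewrite min_r ?mulVf ?gt_eqF// lef_pV2.
by rewrite min_l ?mulVf ?gt_eqF// lef_pV2// ltW.
Qed.

Lemma step_bound_ge0 t : 0 <= step_bound t.
Proof. by rewrite invr_ge0 mulr_ge0 ?powR_ge0. Qed.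

Lemma step_bound1 : step_bound 1 = 1.
Proof. by rewrite /step_bound ln1 addr0 !powR1 mulr1 invr1. Qed.

Lemma step_bound_le s t : (0 < s)%N -> (s <= t)%N -> step_bound t <= step_bound s.
Proof.
move=> s0 st; have t0 := leq_trans s0 st.
by rewrite lef_pV2 ?posrE ?denominator_gt0// denominator_le.
Qed.

Lemma step_bound_le1 t : (0 < t)%N -> step_bound t <= 1.
Proof. by move=> t0; rewrite -step_bound1 step_bound_le. Qed.

Let log_pow_ge1 t : (0 < t)%N -> 1 <= (1 + ln t%:R : R) `^ gamma.
Proof.
move=> t0; have l0 := @ln_nat_ge0 R t.
rewrite -[leLHS](powRr0 (1 + ln t%:R)); apply: ler_powR; step_lra.
Qed.

(** Here [mu + 1/2 <= kappa] enters: [2 (kappa - mu) >= 1], and the logarithmic factor is at least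
    [1], so squaring it only helps. *)
Lemma step_bound_sqr_le t : (0 < t)%N -> step_bound t ^+ 2 <= log_term gamma t.
Proof.
move=> t0; rewrite /step_bound /log_term exprVn lef_pV2 ?posrE ?exprn_gt0 ?denominator_gt0//; last first.
  by rewrite mulr_gt0 ?ltr0n// (lt_le_trans ltr01)// log_pow_ge1.
have L1 := log_pow_ge1 t0; have [k1 k2] := kmu.
have t1 : 1 <= t%:R :> R by rewrite ler1n.
rewrite exprMn ler_pM//; first step_lra; first by rewrite expr2 ler_peMl//; step_lra.
rewrite -powR_mulrn ?powR_ge0// -powRrM.
by rewrite -[leLHS]powRr1// ler_powR//; step_lra.
Qed.

(** Here [1 - mu (p - 1) <= kappa] enters: since [la t >= t^mu], the denominator carries [t] to an
    exponent of at least [kappa - mu + mu p >= 1]. *)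
Lemma step_bound_lambda_le t : (0 < t)%N -> step_bound t * la t `^ (- p) <= log_term gamma t.
Proof.
move=> t0; have L1 := log_pow_ge1 t0; have [k1 k2] := kmu.
have t1 : 1 <= t%:R :> R by rewrite ler1n.
rewrite powRN /step_bound /log_term -invfM.
have lp : 0 < la t `^ p by rewrite powR_gt0// lambda_gt0.
have L0 : 0 < (1 + ln t%:R : R) `^ gamma by exact: lt_le_trans L1.
have T0 : 0 < (t%:R : R) `^ (kappa - mu) by rewrite powR_gt0// ltr0n.
rewrite lef_pV2 ?posrE ?mulr_gt0 ?ltr0n//.
rewrite -mulrA ler_wpM2l ?powR_ge0//.
apply: (@le_trans _ _ (t%:R `^ (kappa - mu) * t%:R `^ (mu * p))).
  rewrite -powRD ?pnatr_eq0 ?(gtn_eqF t0) ?implybT//.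
  by rewrite -[leLHS]powRr1// ler_powR//; step_lra.
rewrite ler_wpM2l ?powR_ge0// powRrM ge0_ler_powR ?nnegrE ?powR_ge0 ?(ltW (lambda_gt0 t)) ?lambda_ge_pow//.
by rewrite ltW// (lt_trans ltr01).
Qed.

Lemma alpha_lambda_pow t : (0 < t)%N -> al t * la t `^ (1 - p) = step_bound t * la t `^ (- p).
Proof.
move=> t0; rewrite -alpha_lambda// -mulrA; congr (_ * _).
by rewrite powRD ?(gt_eqF (lambda_gt0 t)) ?implybT// powRr1 ?ltW ?lambda_gt0.
Qed.

Lemma lambda_pow_le1 t (q : R) : (0 < t)%N -> 0 <= q -> la t `^ (- q) <= 1.
Proof.
move=> t0 q0; rewrite -[leRHS](powRr0 (la t)); apply: ler_powR; first exact: lambda_ge1.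
by rewrite oppr_le0.
Qed.

Let log_bound := log_term_bound gamma1.
Let p0 : 0 <= p. Proof. by rewrite ltW// (lt_trans ltr01). Qed.

(** For [t > P] both [t] and [tau P t] are at least [t - P], so the term is at most the squared step
    bound at [t - P]; the earlier terms are at most [1]. *)
Lemma C1_bound : partial_bound (fun t => al t * al (tau P t) * la t * la (tau P t))
  (P%:R + (1 + (gamma - 1)^-1)).
Proof.
apply: partial_bound_le (partial_bound_shift P _ log_bound); last by move=> *; exact: log_term_ge0.
move=> t t0.
have -> : al t * al (tau P t) * la t * la (tau P t) =
  (al t * la t) * (al (tau P t) * la (tau P t)) by ring.
rewrite !alpha_lambda ?tau_gt0//; case: ifPn => [_|].
  by apply: mulr_ile1; rewrite ?step_bound_ge0// step_bound_le1// tau_gt0.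
rewrite -ltnNge => Pt; have tP : (0 < t - P)%N by rewrite subn_gt0.
apply: le_trans (step_bound_sqr_le tP); rewrite expr2 ler_pM ?step_bound_ge0//.
  by rewrite step_bound_le// leq_subr.
by rewrite step_bound_le// leq_subLR addnC tau_ge.
Qed.

Lemma C1_ge0 t : (0 < t)%N -> 0 <= al t * al (tau P t) * la t * la (tau P t).
Proof.
move=> t0; have -> : al t * al (tau P t) * la t * la (tau P t) =
  (al t * la t) * (al (tau P t) * la (tau P t)) by ring.
by rewrite !alpha_lambda ?tau_gt0// mulr_ge0 ?step_bound_ge0.
Qed.

Lemma C2_bound : partial_bound (fun t => al t * la t `^ (1 - p)) (1 + (gamma - 1)^-1).
Proof.
by apply: partial_bound_le log_bound => t t0; rewrite alpha_lambda_pow// step_bound_lambda_le.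
Qed.

Lemma C3_bound : partial_bound (fun t => al t ^+ 2 * la t `^ (2 - 2 * p)) (1 + (gamma - 1)^-1).
Proof.
apply: partial_bound_le log_bound => t t0.
have -> : la t `^ (2 - 2 * p) = (la t `^ (1 - p)) ^+ 2.
  by rewrite -powR_mulrn ?powR_ge0// -powRrM; congr (_ `^ _); ring.
rewrite -exprMn alpha_lambda_pow//; apply: le_trans (step_bound_sqr_le t0).
rewrite ler_pXn2r ?nnegrE ?mulr_ge0 ?step_bound_ge0 ?powR_ge0//.
by rewrite ler_piMr ?step_bound_ge0// lambda_pow_le1.
Qed.

Lemma C4_bound : partial_bound (fun t => (al t * la t) ^+ 2 * la t `^ (- p)) (1 + (gamma - 1)^-1).
Proof.
apply: partial_bound_le log_bound => t t0; rewrite alpha_lambda//.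
apply: le_trans (step_bound_sqr_le t0).
by rewrite ler_piMr ?sqr_ge0// lambda_pow_le1.
Qed.

Lemma C5_bound : partial_bound (fun t => (al t * la t) ^+ 4 * la t `^ (- p)) (1 + (gamma - 1)^-1).
Proof.
apply: partial_bound_le C4_bound => t t0; rewrite alpha_lambda// ler_wpM2r ?powR_ge0//.
by rewrite ler_wiXn2l ?step_bound_ge0 ?step_bound_le1.
Qed.

End StepSizes.

(** * The deterministic recursion along one sample path *)

Section Path.
Context {R : realType} {n m : nat} (X : set 'rV[R]_n) (f : 'I_m -> 'rV[R]_n -> R)
  (gf : 'I_m -> 'rV[R]_n -> 'rV[R]_n) (xstar : 'rV[R]_n)
  (Phi : 'rV[R]_n -> R) (gPhi : 'rV[R]_n -> 'rV[R]_n) (Per : nat)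
  (x y c : 'I_m -> nat -> 'rV[R]_n) (G R1 : R) (al la : nat -> R).
Hypotheses (cX : convex_set X) (cf : forall i, convex_on X (f i))
  (gradf : forall i, gradient_on X (f i) (gf i)) (Xstar : X xstar)
  (fmin : forall z, X z -> \sum_(i < m) f i xstar <= \sum_(i < m) f i z)
  (gradPhi : gradient_on X Phi gPhi)
  (sc : forall u v, X u -> X v ->
     dotv (gPhi v) (u - v) + 2^-1 * enorm (u - v) ^+ 2 <= Phi u - Phi v)
  (A3 : forall z (ys : 'I_m -> 'rV[R]_n) (a : 'I_m -> R), X z -> (forall j, X (ys j)) ->
     (forall j, 0 <= a j) -> \sum_(j < m) a j = 1 ->
     bregman Phi gPhi z (\sum_(j < m) a j *: ys j)
       <= \sum_(j < m) a j * bregman Phi gPhi z (ys j))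
  (gfG : forall i z, X z -> enorm (gf i z) <= G)
  (Per0 : (0 < Per)%N) (Xx1 : forall i, X (x i 1%N))
  (Xy : forall i t, (0 < t)%N -> X (y i t.+1))
  (opt : forall i t z, (0 < t)%N -> X z ->
     0 <= dotv (al t *: c i t + gPhi (y i t.+1) - gPhi (x i t)) (z - y i t.+1))
  (cla : forall i t, (0 < t)%N -> enorm (c i t) <= la t)
  (xy : forall i t, (0 < t)%N -> x i t.+1 = if comm_instant Per t.+1
                  then m%:R^-1 *: \sum_(j < m) y j t.+1 else y i t.+1)
  (R1P : forall i, Num.sqrt (2 * bregman Phi gPhi xstar (x i 1%N)) <= R1)
  (al0 : forall t, (0 < t)%N -> 0 < al t)
  (la0 : forall t, 2 * G <= la t)
  (ale : forall s t, (0 < s)%N -> (s <= t)%N -> al t * la t <= al s * la s)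
  (al1 : al 1%N * la 1%N = 1) (age0 : forall t, 0 <= al t * la t) (l : 'I_m).

Let D t := \sum_(i < m) bregman Phi gPhi xstar (x i t).

Let m0 : (0 < m)%N. Proof. exact: leq_ltn_trans (ltn_ord l). Qed.

Lemma iterate_in i t : (0 < t)%N -> X (x i t).
Proof.
case: t => // -[_|t _]; first exact: Xx1.
rewrite xy//; case: ifP => _; last exact: Xy.
have := @convex_set_average _ _ X _ (fun j => y j t.+2) (index_enum 'I_m) cX.
rewrite /index_enum -enumT size_enum_ord; apply => // j; exact: Xy.
Qed.

Lemma local_move i t : (0 < t)%N -> enorm (y i t.+1 - x i t) <= al t * la t.
Proof.
move=> t0; apply: (mirror_move sc (al0 t0) (iterate_in i t0) (Xy i t0) (cla i t0)).
exact: opt (iterate_in i t0).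
Qed.

Lemma drift i s t : (0 < s)%N -> (s <= t)%N ->
  (forall r, (s < r <= t)%N -> ~~ comm_instant Per r) ->
  enorm (x i t - x i s) <= (t - s)%:R * (al s * la s).
Proof.
move=> s0; elim: t => [|t IH]; first by rewrite leqn0 => /eqP s00; rewrite s00 in s0.
rewrite leq_eqVlt => /predU1P[<- _|]; first by rewrite subrr enorm0 subnn mul0r.
rewrite ltnS => st nc.
have t0 := leq_trans s0 st.
have xt : x i t.+1 = y i t.+1 by rewrite xy// (negbTE (nc _ _))// ltnS st leqnn.
have -> : x i t.+1 - x i s = (y i t.+1 - x i t) + (x i t - x i s).
  by rewrite xt addrA subrK.
apply: le_trans (enorm_triangle _ _) _.
rewrite subSn// -natr1 mulrDl mul1r addrC lerD//.
  by apply: IH => // r /andP[sr rt]; apply: nc; rewrite sr ltnW.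
by apply: le_trans (local_move i t0) _; exact: ale.
Qed.

Lemma dist_le_bregman z : X z -> enorm (z - xstar) ^+ 2 <= 2 * bregman Phi gPhi xstar z.
Proof.
by move=> Xz; have := bregman_ge sc Xstar Xz; rewrite enorm_distC; lra.
Qed.

Lemma R1_ge0 : 0 <= R1.
Proof. by apply: le_trans (R1P l); rewrite sqrtr_ge0. Qed.

Lemma bregman_init i : bregman Phi gPhi xstar (x i 1%N) <= R1 ^+ 2 / 2.
Proof.
have b0 : 0 <= 2 * bregman Phi gPhi xstar (x i 1%N).
  by apply: le_trans (dist_le_bregman (Xx1 i)); rewrite sqr_ge0.
have : 2 * bregman Phi gPhi xstar (x i 1%N) <= R1 ^+ 2.
  by rewrite -(sqr_sqrtr b0) ler_pXn2r ?nnegrE ?sqrtr_ge0 ?R1_ge0.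
lra.
Qed.

Lemma init_dist i : enorm (x i 1%N - xstar) <= R1.
Proof.
rewrite -(@ler_pXn2r _ 2) ?nnegrE ?enorm_ge0 ?R1_ge0//.
apply: le_trans (dist_le_bregman (Xx1 i)) _; have := bregman_init i; lra.
Qed.

(* The initial points may differ, so before the first communication the agents are only
   within [2 R1] of each other; this is absorbed because [al 1 * la 1 = 1]. *)
Lemma consensus i t : (0 < t)%N ->
  enorm (x l t - x i t) <= 2 * (Per%:R + R1) * (al (tau Per t) * la (tau Per t)).
Proof.
move=> t0; have R10 := R1_ge0.
have c0 : 0 <= 2 * (Per%:R + R1) :> R by rewrite mulr_ge0// addr_ge0.
have same s : comm_instant Per s -> x l s = x i s.
  case: s => [//|[//|s]] cs; first by rewrite !xy// cs.
have [tP|Pt|->] := ltngtP t Per.+1; last first.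
- have cP : comm_instant Per Per.+1 by rewrite /comm_instant /= dvdnn andbT ltnS.
  by rewrite (same _ cP) subrr enorm0; apply: mulr_ge0.
- have tc : comm_instant Per (tau Per t) by exact: tau_large.
  have dj j := @drift j (tau Per t) t (tau_gt0 _ _) (tau_le _ t0) (fun r h =>
    no_comm_after_tau Per0 h (negbT (gtn_eqF Pt))).
  have -> : x l t - x i t = (x l t - x l (tau Per t)) - (x i t - x i (tau Per t)).
    by rewrite (same _ tc) opprB addrA subrK.
  apply: le_trans (enorm_triangle _ _) _; rewrite enormN.
  apply: le_trans (lerD (dj l) (dj i)) _.
  rewrite -mulrDl ler_wpM2r//.
  have : (t - tau Per t)%:R <= Per%:R :> R by rewrite ler_nat leq_subLR tau_ge.
  lra.
- have t1 : tau Per t = 1%N by apply: tau_small; exact: ltnW.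
  have nc r : (1 < r <= t)%N -> ~~ comm_instant Per r.
    move=> h; apply: (@no_comm_after_tau Per Per0 t); rewrite ?t1//.
    by rewrite ltn_eqF.
  have dj j := @drift j 1%N t isT t0 nc.
  have -> : x l t - x i t = (x l t - x l 1%N) - (x i t - x i 1%N) +
      ((x l 1%N - xstar) - (x i 1%N - xstar)).
    by rewrite !opprB !addrA; apply/rowP => k; rewrite !mxE; ring.
  rewrite t1; apply: le_trans (enorm_triangle _ _) _.
  apply: le_trans (lerD (enorm_triangle _ _) (enorm_triangle _ _)) _; rewrite !enormN.
  have := dj l; have := dj i; have := init_dist l; have := init_dist i.
  have : (t - 1)%:R <= Per%:R :> R by rewrite ler_nat leq_subLR ltnW.
  rewrite al1; lra.
Qed.

(** At a communication instant all [m] agents sit at the same average, and (A3) with equal weights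
    shows that averaging does not increase the total divergence. *)
Lemma comm_bregman t : (0 < t)%N ->
  D t.+1 <= \sum_(i < m) bregman Phi gPhi xstar (y i t.+1).
Proof.
move=> t0; rewrite /D; case cE: (comm_instant Per t.+1); last first.
  by apply: ler_sum => i _; rewrite xy// cE.
have mR : m%:R != 0 :> R by rewrite pnatr_eq0 -lt0n.
under eq_bigr => i _ do rewrite xy// cE.
rewrite sumr_const card_ord scaler_sumr.
have := @A3 xstar (fun j => y j t.+1) (fun=> m%:R^-1) Xstar (fun j => Xy j t0).
move=> h.
rewrite -[leLHS]mulr_natl.
apply: (@le_trans _ _ (m%:R * \sum_(j < m) m%:R^-1 * bregman Phi gPhi xstar (y j t.+1))).
  rewrite ler_pM2l ?ltr0n//; apply: h => //.
  by rewrite sumr_const card_ord -[LHS]mulr_natl divff.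
by rewrite -mulr_sumr mulrA divff// mul1r.
Qed.

Definition noise t : R :=
  \sum_(i < m) - al t * dotv (c i t - gf i (x i t)) (x i t - xstar).

(** Each agent's mirror step is compared with [xstar], using the gradient inequality at its own
    iterate; moving the function value from [x i t] to [x l t] costs the gradient bound times the
    consensus distance. *)
Lemma one_step t : (0 < t)%N ->
  al t * (\sum_(i < m) f i (x l t) - \sum_(i < m) f i xstar) + D t.+1 <=
  D t + m%:R / 2 * (al t * la t) ^+ 2
  + m%:R * (Per%:R + R1) * ((al t * la t) * (al (tau Per t) * la (tau Per t))) + noise t.
Proof.
move=> t0; have alt := al0 t0; have Xl := iterate_in l t0.
set a := al t in alt *; set b := (_ * la (tau Per t)).
have key i : a * (f i (x l t) - f i xstar) + bregman Phi gPhi xstar (y i t.+1) <=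
  bregman Phi gPhi xstar (x i t) + 2^-1 * (a * la t) ^+ 2
   + (Per%:R + R1) * ((a * la t) * b)
   + (- a * dotv (c i t - gf i (x i t)) (x i t - xstar)).
  have Xi := iterate_in i t0.
  have h1 := mirror_step sc alt Xi (Xy i t0) Xstar (cla i t0) (opt i t0 Xstar).
  have h2 := convex_gradient cX (cf i) (gradf i) Xi Xstar.
  have h3 := convex_gradient cX (cf i) (gradf i) Xl Xi.
  have h4 : dotv (gf i (x l t)) (x l t - x i t) <= G * (2 * (Per%:R + R1) * b).
    apply: le_trans (dotv_le _ _) _; apply: ler_pM; rewrite ?enorm_ge0//; first exact: gfG.
    exact: consensus.
  (* The bound [2 * G <= la t] replaces the gradient bound by [la t], so that the consensus cost
     becomes a term of the series [C1]. *)
  have h5 : a * (f i (x l t) - f i (x i t)) <= a * (la t * ((Per%:R + R1) * b)).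
    rewrite ler_pM2l//.
    have -> : f i (x l t) - f i (x i t) = - (f i (x i t) - f i (x l t)) by ring.
    apply: (@le_trans _ _ (2 * G * ((Per%:R + R1) * b))).
      move: h3 h4; rewrite !dotvE; lra.
    apply: ler_wpM2r; last exact: la0.
    by apply: mulr_ge0; [rewrite addr_ge0 ?R1_ge0|exact: age0].
  have h6 : a * (f i (x i t) - f i xstar) <= a * dotv (gf i (x i t)) (x i t - xstar).
    by rewrite ler_pM2l//; move: h2; rewrite !dotvE; lra.
  move: h1 h5 h6; rewrite dotvBl; lra.
rewrite -sumrB mulr_sumr.
apply: (@le_trans _ _ (\sum_(i < m) (a * (f i (x l t) - f i xstar) + bregman Phi gPhi xstar (y i t.+1)))).
  by rewrite big_split lerD2l comm_bregman.
apply: (le_trans (ler_sum _ (fun i _ => key i))).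
rewrite 3!big_split /= !sumr_const !card_ord /D /noise.
rewrite le_eqVlt; apply/orP; left; apply/eqP; congr (_ + _).
rewrite -[(2^-1 * _) *+ m]mulr_natl -[((Per%:R + R1) * _) *+ m]mulr_natl.
by rewrite !mulrA.
Qed.

Lemma path_bound T :
  \sum_(1 <= t < T.+1) al t * (\sum_(i < m) f i (x l t) - \sum_(i < m) f i xstar) + D T.+1 <=
  D 1 + m%:R / 2 * \sum_(1 <= t < T.+1) (al t * la t) ^+ 2
  + m%:R * (Per%:R + R1) *
     \sum_(1 <= t < T.+1) (al t * la t) * (al (tau Per t) * la (tau Per t))
  + \sum_(1 <= t < T.+1) noise t.
Proof.
elim: T => [|T IH]; first by rewrite !big_geq// !mulr0 !addr0 add0r.
rewrite !(@big_nat_recr _ _ _ T.+1)//= !mulrDr.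
have := one_step (ltn0Sn T); lra.
Qed.

End Path.

(** * Rational boxes as a countable neighbourhood base *)

Section RationalBoxes.
Context {R : realType} {n : nat}.

Lemma harmonic_lt (e : R) : 0 < e -> exists N : nat, N.+1%:R^-1 < e.
Proof. by move=> /ltr_add_invr[N]; rewrite add0r => h; exists N. Qed.

Definition rational_box (c : 'rV[rat]_n * nat) : set 'rV[R]_n :=
  [set z | forall k, `|z ord0 k - ratr (c.1 ord0 k)| < c.2.+1%:R^-1].

Lemma rational_box_near (z : 'rV[R]_n) (N : nat) :
  exists q, rational_box (q, N) z.
Proof.
have e0 : 0 < N.+1%:R^-1 :> R by rewrite invr_gt0.
have h k : exists q : rat, `|z ord0 k - ratr q| < N.+1%:R^-1.
  have /rat_in_itvoo[q] : z ord0 k < z ord0 k + N.+1%:R^-1 by rewrite ltrDl.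
  rewrite in_itv/= => /andP[q1 q2]; exists q.
  by rewrite distrC ger0_norm ?subr_ge0 ?(ltW q1)// ltrBlDl.
exists (\row_k sval (cid (h k))) => k /=; rewrite mxE.
exact: (svalP (cid (h k))).
Qed.

Lemma rational_box_sub (z : 'rV[R]_n) (U : set 'rV[R]_n) : nbhs z U ->
  exists c, rational_box c z /\ rational_box c `<=` U.
Proof.
move=> /nbhs_ballP[e /= e0 zU].
have [|N hN] := @harmonic_lt (e / 2); first by rewrite divr_gt0.
have [q hq] := rational_box_near z N; exists (q, N); split => // u hu.
apply: zU; split => // i k; rewrite !ord1 /ball/=.
have -> : z ord0 k - u ord0 k = (z ord0 k - ratr (q ord0 k)) - (u ord0 k - ratr (q ord0 k)) by ring.
apply: le_lt_trans (ler_normB _ _) _.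
have := hq k; have := hu k => /=; move: hN; set a := _^-1; lra.
Qed.

(** Rational points may miss [X], so one point of [X] is chosen in every rational box that meets
    [X]; [x0] fills the other indices. *)
Lemma dense_sequence (X : set 'rV[R]_n) (x0 : 'rV[R]_n) : X x0 ->
  exists D : nat -> 'rV[R]_n, (forall j, X (D j)) /\
    forall z U, X z -> nbhs z U -> exists j, U (D j).
Proof.
move=> Xx0.
pose F (c : 'rV[rat]_n * nat) : 'rV[R]_n :=
  if pselect (exists z, X z /\ rational_box c z) is left h then sval (cid h) else x0.
have FX c : X (F c).
  by rewrite /F; case: pselect => // h; case: (svalP (cid h)).
exists (fun j => if unpickle j is Some c then F c else x0); split.
  by move=> j; case: unpickle.
move=> z U Xz /rational_box_sub[c [zc cU]]; exists (pickle c); rewrite pickleK.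
apply: cU; rewrite /F; case: pselect => [h|]; first by case: (svalP (cid h)).
by case; exists z.
Qed.

End RationalBoxes.

(** * Measurability of the mirror step *)

Section Measurability.
Context {R : realType} {n : nat} {d : measure_display} {T : measurableType d}.
Implicit Types (x y : T -> 'rV[R]_n) (X : set 'rV[R]_n).

(** Vector measurability is taken coordinatewise, over an arbitrary measurable type, so that the
    lemmas also apply to [Omega] carrying a smaller sigma-algebra. *)
Definition coord_measurable x := forall k, measurable_fun setT (fun w => x w ord0 k).

Lemma measurable_fun_lt_rays (h : T -> R) :
  (forall c, measurable [set w | h w < c]) -> measurable_fun setT h.
Proof.
move=> H mT; apply: (measurability _ (RGenInftyO.measurableE R)) => //.
move=> _ [_ [c ->] <-]; rewrite setTI.
rewrite [X in measurable X](_ : _ = [set w | h w < c])//.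
Qed.

Lemma measurable_fun_le_rays (h : T -> R) :
  (forall c, measurable [set w | h w <= c]) -> measurable_fun setT h.
Proof.
move=> H; apply: measurable_fun_lt_rays => c.
rewrite [X in measurable X](_ : _ = \bigcup_N [set w | h w <= c - N.+1%:R^-1]).
  exact: bigcupT_measurable.
apply/seteqP; split => w /=.
  rewrite -subr_gt0 => /harmonic_lt[N hN]; exists N => //=.
  by rewrite lerBrDr -lerBrDl ltW.
move=> [N _ /=] /le_lt_trans; apply; by rewrite ltrBlDr ltrDl invr_gt0.
Qed.

Lemma measurable_le_const (h : T -> R) (c : R) : measurable_fun setT h -> measurable [set w | h w <= c].
Proof.
move=> mh; have := measurable_fun_le measurableT mh (@measurable_cst _ _ _ _ setT c).
by rewrite setTI.
Qed.

Lemma measurable_lt_const (h : T -> R) (c : R) : measurable_fun setT h -> measurable [set w | h w < c].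
Proof.
move=> mh; have := measurable_fun_le measurableT (@measurable_cst _ _ _ _ setT c) mh.
rewrite setTI => /measurableC; rewrite [X in measurable X -> _](_ : _ = [set w | h w < c])//.
by apply/seteqP; split => w /=; rewrite ltNge => /negP.
Qed.

Lemma measurable_rational_box x c : coord_measurable x -> measurable (x @^-1` rational_box c).
Proof.
move=> mx.
rewrite [X in measurable X](_ : _ = \bigcap_(k in [set: 'I_n])
   [set w | `|x w ord0 k - ratr (c.1 ord0 k)| < c.2.+1%:R^-1]).
  apply: fin_bigcap_measurable => // k _; apply: measurable_lt_const.
  apply: measurableT_comp => //.
  by apply: measurable_funB => //; exact: mx.
by apply/seteqP; split => w /= h k; [move=> _|]; apply: h.
Qed.

Lemma measurable_countU (I : countType) (F : I -> set T) :
  (forall i, measurable (F i)) -> measurable (\bigcup_i F i).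
Proof.
move=> mF.
rewrite [X in measurable X](_ : _ = \bigcup_j (if unpickle j is Some i then F i else set0)).
  by apply: bigcupT_measurable => j; case: unpickle.
apply/seteqP; split => w [].
  by move=> i _ Fw; exists (pickle i) => //; rewrite pickleK.
by move=> j _; case: unpickle => // i Fw; exists i.
Qed.

(** Continuity is known only at points of [X], so the preimage of a ray is written as a countable
    union over the rational boxes whose points in [X] satisfy the inequality. *)
Lemma continuous_on_measurable X (h : 'rV[R]_n -> R) x :
  (forall z, X z -> {for z, continuous h}) -> (forall w, X (x w)) ->
  coord_measurable x -> measurable_fun setT (h \o x).
Proof.
move=> ch Xx mx; apply: measurable_fun_lt_rays => c.
rewrite [X in measurable X](_ : _ = \bigcup_(b in [set b : 'rV[rat]_n * nat |
    X `&` rational_box b `<=` [set z | h z < c]]) (x @^-1` rational_box b)).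
  rewrite bigcup_mkcond; apply: measurable_countU => b.
  by case: ifP => // _; exact: measurable_rational_box.
apply/seteqP; split => w /=.
  move=> hc; have : nbhs (x w) [set z | h z < c].
    exact: (cvgr_lt _ (ch _ (Xx w))).
  by move=> /rational_box_sub[b [bx bU]]; exists b => //= z [_] /bU.
by move=> [b /= bU bx]; apply: bU.
Qed.

Lemma dotv_measurable x y : coord_measurable x -> coord_measurable y ->
  measurable_fun setT (fun w => dotv (x w) (y w)).
Proof.
move=> mx my; have := @measurable_sum _ T R setT _ (index_enum 'I_n)
  (fun k w => x w ord0 k * y w ord0 k); apply => k.
by apply: measurable_funM; [exact: mx|exact: my].
Qed.

Lemma coord_measurable_cst (z : 'rV[R]_n) : coord_measurable (fun=> z).
Proof. by move=> k; exact: measurable_cst. Qed.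

Lemma coord_measurableD x y : coord_measurable x -> coord_measurable y ->
  coord_measurable (fun w => x w + y w).
Proof.
move=> mx my k; rewrite (_ : (fun w => _) = (fun w => x w ord0 k) \+ (fun w => y w ord0 k)).
  by apply: measurable_funD; [exact: mx|exact: my].
by apply/funext => w /=; rewrite mxE.
Qed.

Lemma coord_measurableZ (a : T -> R) x : measurable_fun setT a -> coord_measurable x ->
  coord_measurable (fun w => a w *: x w).
Proof.
move=> ma mx k; rewrite (_ : (fun w => _) = a \* (fun w => x w ord0 k)).
  by apply: measurable_funM => //; exact: mx.
by apply/funext => w /=; rewrite mxE.
Qed.

Lemma coord_measurableB x y : coord_measurable x -> coord_measurable y ->
  coord_measurable (fun w => x w - y w).
Proof.
move=> mx my k; rewrite (_ : (fun w => _) = (fun w => x w ord0 k) \- (fun w => y w ord0 k)).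
  by apply: measurable_funB; [exact: mx|exact: my].
by apply/funext => w /=; rewrite !mxE.
Qed.

Lemma coord_measurable_sum (I : Type) (s : seq I) (F : I -> T -> 'rV[R]_n) :
  (forall i, coord_measurable (F i)) -> coord_measurable (fun w => \sum_(i <- s) F i w).
Proof.
move=> mF k; rewrite (_ : (fun w => _) = (fun w => \sum_(i <- s) F i w ord0 k)).
  by have := @measurable_sum _ T R setT _ s (fun i w => F i w ord0 k); apply => i; exact: mF.
by apply/funext => w; rewrite summxE.
Qed.

Lemma enorm_measurable x : coord_measurable x -> measurable_fun setT (fun w => enorm (x w)).
Proof.
move=> mx; apply: measurable_fun_lt_rays => c.
have [c0|c0] := ltP 0 c; last first.
  rewrite (_ : [set _ | _] = set0)//; apply/seteqP; split => w //=.
  by rewrite ltNge (le_trans c0) ?enorm_ge0.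
rewrite [X in measurable X](_ : _ = [set w | dotv (x w) (x w) < c ^+ 2]).
  by apply: measurable_lt_const; exact: dotv_measurable.
apply/seteqP; split => w /=; rewrite -enorm_sqr ltr_pXn2r ?nnegrE ?enorm_ge0//; exact: ltW.
Qed.

Lemma clip_measurable (lam : R) x : coord_measurable x -> coord_measurable (fun w => clip lam (x w)).
Proof.
move=> mx; apply: coord_measurableZ => //.
apply: measurable_minr => //.
apply: measurable_funM => //.
(* The inverse agrees, also at [0], with the power of exponent [-1], a measurable function. *)
rewrite (_ : (fun _ => _) = (fun w => enorm (x w) `^ (-1))).
  by have := measurableT_comp (@measurable_powR R (-1)) (enorm_measurable mx).
by apply/funext => w; rewrite powR_inv1 ?enorm_ge0.
Qed.

(* Nothing ensures that [gh \o x] is measurable: [h] is arbitrary off [X], so only for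
   directions tangent to [X] is [gh] a limit of difference quotients taken inside [X]. *)
Lemma gradient_measurable X (h : 'rV[R]_n -> R) gh x z z' : convex_set X ->
  gradient_on X h gh -> (forall w, X (x w)) -> X z -> X z' -> coord_measurable x ->
  measurable_fun setT (fun w => dotv (gh (x w)) (z - z')).
Proof.
move=> cX gr Xx Xz Xz' mx.
have ch u : X u -> {for u, continuous h} by move=> /gr[/differentiable_continuous].
suff H u : X u -> measurable_fun setT (fun w => dotv (gh (x w)) (u - x w)).
  rewrite (_ : (fun w => _) = (fun w => dotv (gh (x w)) (z - x w)) \-
      (fun w => dotv (gh (x w)) (z' - x w))).
    by apply: measurable_funB; exact: H.
  by apply/funext => w /=; rewrite -dotvBr; congr dotv; rewrite opprB addrA subrK.
move=> Xu.
apply: (measurable_fun_cvg (h := fun N w => N.+1%:R * (h (x w + N.+1%:R^-1 *: (u - x w)) - h (x w)))).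
  move=> N; apply: measurable_funM => //; apply: measurable_funB.
    apply: (continuous_on_measurable (X := X)) => // [w|].
      by apply: convex_set_step => //; rewrite invr_ge0 ler0n/= invf_le1 ?ler1n.
    apply: coord_measurableD => //; apply: coord_measurableZ => //.
    by apply: coord_measurableB => //; exact: coord_measurable_cst.
  exact: (continuous_on_measurable (X := X)).
move=> w _; have [dh <-] := gr _ (Xx w); exact: directional_limit.
Qed.

Lemma coord_sqr_le (u : 'rV[R]_n) k : u ord0 k ^+ 2 <= dotv u u.
Proof.
rewrite /dotv (bigD1 k)//= -expr2 lerDl; apply: sumr_ge0 => i _.
by rewrite -expr2 sqr_ge0.
Qed.

(* By the quadratic growth of [psi w] at [y w], every near-minimizer is close to [y w]; so
   [y w ord0 k <= c] is a countable condition on a dense sequence of [X]. *)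
Lemma argmin_measurable X (psi : T -> 'rV[R]_n -> R) y (x0 : 'rV[R]_n) : X x0 ->
  (forall w z, X z -> {for z, continuous (psi w)}) ->
  (forall z z', X z -> X z' -> measurable_fun setT (fun w => psi w z - psi w z')) ->
  (forall w, X (y w)) ->
  (forall w z, X z -> psi w (y w) + 2^-1 * enorm (z - y w) ^+ 2 <= psi w z) ->
  coord_measurable y.
Proof.
move=> Xx0 cpsi mpsi Xy ymin k; have [D [XD dD]] := dense_sequence Xx0.
apply: measurable_fun_le_rays => c.
rewrite [X in measurable X](_ : _ = \bigcap_N \bigcup_(j in [set j | D j ord0 k <= c + N.+1%:R^-1])
   \bigcap_i [set w | psi w (D j) - psi w (D i) <= N.+1%:R^-1]).
  apply: bigcapT_measurable => N; apply: bigcup_measurable => j _.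
  by apply: bigcapT_measurable => i; apply: measurable_le_const; exact: mpsi.
have ymin' w z : X z -> psi w (y w) <= psi w z.
  by move=> Xz; apply: le_trans (ymin w z Xz); rewrite lerDl mulr_ge0 ?sqr_ge0.
have near w e : 0 < e -> nbhs (y w) [set z | psi w z < psi w (y w) + e].
  by move=> e0; apply: (cvgr_lt _ (cpsi w _ (Xy w))); rewrite ltrDl.
apply/seteqP; split => w /=.
  move=> yc N _; have e0 : 0 < N.+1%:R^-1 :> R by rewrite invr_gt0.
  have n2 : nbhs (y w) [set z : 'rV[R]_n | z ord0 k < y w ord0 k + N.+1%:R^-1].
    by apply: (cvgr_lt _ (@coord_continuous R 1 n ord0 k (y w))); rewrite ltrDl.
  have [j [/= j1 j2]] := dD _ _ (Xy w) (filterI (near w _ e0) n2).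
  exists j => /=; first by apply: le_trans (ltW j2) _; rewrite lerD2r.
  move=> i _ /=; rewrite lerBlDl; apply: le_trans (ltW j1) _.
  by rewrite lerD2r ymin'.
move=> H; rewrite leNgt; apply/negP => cy.
set e := y w ord0 k - c; have e0 : 0 < e by rewrite subr_gt0.
(* Two slacks of size [1 / (N + 1)] put [D j] at squared distance below [4 / (N + 1) < e^2 / 4] from
   [y w], while the [k]-th coordinates differ by at least [e / 2]. *)
have [|N hN] := @harmonic_lt R (Num.min (e / 2) (e ^+ 2 / 16)).
  by rewrite lt_min !divr_gt0 ?exprn_gt0.
move: hN; rewrite lt_min => /andP[]; have [j /= + j2] := H N I.
set a : R := N.+1%:R^-1 in j2 * => j1 h1 h2.
have a0 : 0 < a by rewrite invr_gt0.
have [i /= i1] := dD _ _ (Xy w) (near w _ a0).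
have := j2 i I => /= j3.
have h3 := ymin w _ (XD j).
have := coord_sqr_le (D j - y w) k; rewrite -enorm_sqr !mxE.
set v := enorm _ ^+ 2 in h3 * => h4.
have h5 : v < e ^+ 2 / 4 by lra.
have h6 : e / 2 <= y w ord0 k - D j ord0 k by rewrite /e in h1 *; lra.
have : (e / 2) ^+ 2 <= (y w ord0 k - D j ord0 k) ^+ 2.
  by rewrite ler_pXn2r ?nnegrE//; lra.
lra.
Qed.

Lemma dotv_continuous (v : 'rV[R]_n) : continuous (dotv v).
Proof.
apply: (@continuous_big R 'I_n +%R 0 xpredT _ 'rV[R]_n (index_enum 'I_n)
  (fun k (u : 'rV[R]_n) => v ord0 k * u ord0 k)) => [|k _ z]; first exact: add_continuous.
have h := @coord_continuous R 1 n ord0 k z.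
exact: (cvgM (cvg_cst (v ord0 k)) h).
Qed.

(** Differences of the objective contain [gPhi (x w)] only paired with [z - z'], exactly the pairing
    that [gradient_measurable] handles. *)
Lemma mirror_step_measurable X (Phi : 'rV[R]_n -> R) gPhi (a : R) (c x y : T -> 'rV[R]_n) :
  convex_set X -> gradient_on X Phi gPhi ->
  (forall u v, X u -> X v ->
     dotv (gPhi v) (u - v) + 2^-1 * enorm (u - v) ^+ 2 <= Phi u - Phi v) ->
  0 < a -> (forall w, X (x w)) -> (forall w, X (y w)) ->
  (forall w z, X z -> 0 <= dotv (a *: c w + gPhi (y w) - gPhi (x w)) (z - y w)) ->
  coord_measurable c -> coord_measurable x -> coord_measurable y.
Proof.
move=> cX gr sc a0 Xx Xy opt mc mx.
apply: (@argmin_measurable X (fun w z => a * dotv (c w) z + Phi z - dotv (gPhi (x w)) z)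
  y (y point)) => //.
- move=> w z Xz; have cPhi : {for z, continuous Phi}.
    by have [/differentiable_continuous] := gr _ Xz.
  exact: (cvgB (cvgD (cvgM (cvg_cst a) (@dotv_continuous (c w) z)) cPhi)
    (@dotv_continuous (gPhi (x w)) z)).
- move=> z z' Xz Xz'.
  rewrite (_ : (fun w => _) = (fun w => a * dotv (c w) (z - z') + (Phi z - Phi z')
      - dotv (gPhi (x w)) (z - z'))).
    apply: measurable_funB; last exact: (gradient_measurable cX gr).
    apply: measurable_funD => //; apply: measurable_funM => //.
    by apply: dotv_measurable => //; exact: coord_measurable_cst.
  by apply/funext => w; rewrite !dotvE; ring.
- by move=> w z Xz; apply: (mirror_strong sc) (opt w z Xz).
Qed.

End Measurability.

(** * Conditional expectations and bounded multipliers *)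

Section ConditionalExpectation.
Context {R : realType} {d : measure_display} {Omega : measurableType d}
  (P : probability Omega R).
Implicit Types (H Z X Y : Omega -> R).

Definition integrableR Z := P.-integrable setT (EFin \o Z).

Lemma integrableR_measurable Z : integrableR Z -> measurable_fun setT Z.
Proof. by move=> /measurable_int /measurable_EFinP. Qed.

Lemma bounded_integrableR H (M : R) : measurable_fun setT H -> (forall w, `|H w| <= M) ->
  integrableR H.
Proof.
move=> mH HM; apply: measurable_bounded_integrable => //.
  by rewrite (le_lt_trans (probability_le1 _ _))// ltry.
exists M; split => [|x Mx w _ /=]; first exact: num_real.
exact: le_trans (HM w) (ltW Mx).
Qed.

Lemma integrableR_mul H Z (M : R) : measurable_fun setT H -> (forall w, `|H w| <= M) ->
  integrableR Z -> integrableR (fun w => H w * Z w).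
Proof.
move=> mH HM iZ; have mZ := integrableR_measurable iZ.
have M0 : 0 <= M by apply: le_trans (HM point).
apply: (@le_integrable _ _ _ P setT measurableT _ (EFin \o (fun w => M * Z w))) => //.
- by apply/measurable_EFinP; exact: measurable_funM.
- by move=> w _; rewrite /= lee_fin !normrM (ger0_norm M0) ler_wpM2r.
- have := integrableZl measurableT M iZ.
  by apply: eq_integrable.
Qed.

Lemma integrableR_add X Z : integrableR X -> integrableR Z -> integrableR (fun w => X w + Z w).
Proof. by move=> iX iZ; have := integrableD measurableT iX iZ; apply: eq_integrable. Qed.

Lemma integrableR_sub X Z : integrableR X -> integrableR Z -> integrableR (fun w => X w - Z w).
Proof. by move=> iX iZ; have := integrableB measurableT iX iZ; apply: eq_integrable. Qed.

Lemma integrableR0 : integrableR (fun=> 0).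
Proof. exact: integrable0. Qed.

Lemma integrableR_sum (I : Type) (s : seq I) (F : I -> Omega -> R) :
  (forall i, integrableR (F i)) -> integrableR (fun w => \sum_(i <- s) F i w).
Proof.
move=> iF; elim: s => [|i s IH].
  by under eq_fun do rewrite big_nil; exact: integrableR0.
by under eq_fun do rewrite big_cons; exact: integrableR_add.
Qed.

Lemma Rintegral_bigsum (I : Type) (s : seq I) (F : I -> Omega -> R) :
  (forall i, integrableR (F i)) ->
  \int[P]_w (\sum_(i <- s) F i w) = \sum_(i <- s) \int[P]_w F i w.
Proof.
move=> iF; elim: s => [|i s IH].
  rewrite big_nil; under eq_Rintegral do rewrite big_nil.
  by rewrite Rintegral_cst// mul0r.
under eq_Rintegral do rewrite big_cons.
by rewrite big_cons RintegralD//; [rewrite IH|exact: iF|exact: integrableR_sum].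
Qed.

Variable G : set (set Omega).
Hypothesis Gm : <<s G >> `<=` measurable.

Definition adapted H := measurable_fun (setT : set (g_sigma_algebraType G)) H.

Lemma adapted_measurable H : adapted H -> measurable_fun setT H.
Proof. by move=> aH _ B mB; apply: Gm; apply: (aH measurableT B mB). Qed.

(* [H' = 2 H - 1_{H >= 1/2}] is again an adapted function into [0, 1], and passing from [H]
   to [H'] doubles the integral of [H Z]. *)
Let unit_multiplier_bound Z : integrableR Z ->
  (forall A, <<s G >> A -> \int[P]_(w in A) Z w = 0) ->
  forall (k : nat) H, adapted H -> (forall w, 0 <= H w <= 1) ->
  `|\int[P]_w (H w * Z w)| <= (\int[P]_w `|Z w|) / 2 ^+ k.
Proof.
move=> iZ Z0; elim=> [|k IH] H aH H01.
  have HM w : `|H w| <= 1 by case/andP: (H01 w) => h0 h1; rewrite ger0_norm.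
  have iHZ := integrableR_mul (adapted_measurable aH) HM iZ.
  rewrite expr0 divr1; apply: le_trans (le_normr_Rintegral _ _) _ => //.
  apply: le_Rintegral => //; [exact: integrable_norm|exact: integrable_norm|].
  by move=> w _; rewrite normrM ler_piMl.
pose A := [set w | 2^-1 <= H w].
have FA : <<s G >> A.
  have := @measurable_fun_le _ (g_sigma_algebraType G) R setT (fun=> 2^-1) H measurableT
    (@measurable_cst _ _ _ _ _ _) aH.
  by rewrite setTI.
have mA : measurable A by exact: Gm.
pose H' w := 2 * H w - \1_A w.
have aH' : adapted H'.
  apply: measurable_funB; first by apply: measurable_funM.
  apply: (@measurable_indic _ (g_sigma_algebraType G)); exact: FA.
have H'01 w : 0 <= H' w <= 1.
  rewrite /H' indicE; case/andP: (H01 w) => h0 h1.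
  case: (boolP (w \in A)); first by rewrite inE /A/= => h; lra.
  by rewrite notin_setE /A/= => /negP; rewrite -ltNge => h; lra.
have iA : integrableR (fun w => \1_A w * Z w).
  apply: (@integrableR_mul _ _ 1) => //.
  by move=> w; rewrite indicE; case: (_ \in _); rewrite ?normr1 ?normr0.
have HM w : `|H w| <= 1 by case/andP: (H01 w) => h0 h1; rewrite ger0_norm.
have H'M w : `|H' w| <= 1 by case/andP: (H'01 w) => h0 h1; rewrite ger0_norm.
have iH := integrableR_mul (adapted_measurable aH) HM iZ.
have iH' := integrableR_mul (adapted_measurable aH') H'M iZ.
have A0 : \int[P]_w (\1_A w * Z w) = 0.
  rewrite -(Z0 _ FA) [RHS]Rintegral_mkcond; apply: eq_Rintegral => w _.
  by rewrite patchE indicE; case: (_ \in _); rewrite ?mul1r ?mul0r.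
have e : \int[P]_w (H' w * Z w) = 2 * \int[P]_w (H w * Z w).
  transitivity (\int[P]_w (2 * (H w * Z w) - \1_A w * Z w)).
    by apply: eq_Rintegral => w _; rewrite /H'; ring.
  have i2 : integrableR (fun w => 2 * (H w * Z w)).
    by apply: (@integrableR_mul (fun=> 2) _ 2) => // w; rewrite ger0_norm.
  rewrite RintegralB//.
  by rewrite A0 subr0 RintegralZl.
have := IH H' aH' H'01; rewrite e normrM ger0_norm// exprS invfM.
move=> h; rewrite mulrCA mulrC ler_pdivlMr// mulrC; exact: h.
Qed.

Let unit_multiplier Z H : integrableR Z ->
  (forall A, <<s G >> A -> \int[P]_(w in A) Z w = 0) ->
  adapted H -> (forall w, 0 <= H w <= 1) -> \int[P]_w (H w * Z w) = 0.
Proof.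
move=> iZ Z0 aH H01; apply/eqP; rewrite -normr_le0; apply/ler_addgt0Pr => e e0.
rewrite add0r; set C := \int[P]_w `|Z w|.
have C0 : 0 <= C by apply: Rintegral_ge0.
(* [k] halvings suffice, since [C / e < k < 2^k]. *)
pose k := Num.bound (C / e).
have hk : C / e < k%:R by apply: archi_boundP; rewrite divr_ge0 ?(ltW e0).
apply: le_trans (unit_multiplier_bound iZ Z0 k aH H01) _.
rewrite ler_pdivrMr ?exprn_gt0// mulrC -ler_pdivrMr//.
apply: (le_trans (ltW hk)).
by rewrite -natrX ler_nat ltnW// ltn_expl.
Qed.

Lemma bounded_multiplier Z H (M : R) : integrableR Z ->
  (forall A, <<s G >> A -> \int[P]_(w in A) Z w = 0) ->
  adapted H -> (forall w, `|H w| <= M) -> \int[P]_w (H w * Z w) = 0.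
Proof.
move=> iZ Z0 aH HM.
have M0 : 0 <= M by apply: le_trans (HM point).
(* An affine map sends [[-M, M]] into [[0, 1]]; [M + 1] in place of [M] keeps it nondegenerate when
   [M = 0]. The added constant contributes a multiple of the integral of [Z] over the whole space,
   which is [0]. *)
pose c := 2 * (M + 1); have c0 : 0 < c by rewrite /c; lra.
pose H' w := c^-1 * (H w + (M + 1)).
have aH' : adapted H'.
  by apply: measurable_funM => //; apply: measurable_funD.
have H'01 w : 0 <= H' w <= 1.
  have := HM w; rewrite ler_norml => /andP[h1 h2].
  rewrite /H' mulrC ler_pdivlMr// ler_pdivrMr// mul0r mul1r /c; apply/andP; split; lra.
have := unit_multiplier iZ Z0 aH' H'01.
have H'M w : `|H' w| <= 1 by case/andP: (H'01 w) => h0 h1; rewrite ger0_norm.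
have i1 := integrableR_mul (adapted_measurable aH') H'M iZ.
have i2 := integrableR_mul (adapted_measurable aH) HM iZ.
have i3 : integrableR (fun w => c * (H' w * Z w)).
  by apply: (@integrableR_mul (fun=> c) _ c) => // w; rewrite gtr0_norm.
have i4 : integrableR (fun w => (M + 1) * Z w).
  by apply: (@integrableR_mul (fun=> M + 1) _ (M + 1)) => // w; rewrite ger0_norm ?addr_ge0.
move=> h; transitivity (\int[P]_w (c * (H' w * Z w) - (M + 1) * Z w)).
  by apply: eq_Rintegral => w _; rewrite /H'; field; rewrite gt_eqF.
rewrite RintegralB// RintegralZl// h RintegralZl// Z0 ?mulr0 ?subrr//.
exact: (@measurableT _ (g_sigma_algebraType G)).
Qed.

(** [is_cond_exp] is an identity over events only; bounded adapted weights are what is needed to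
    weight by the exponential of the process so far. *)
Lemma cond_exp_multiplier X Y H (M : R) : is_cond_exp P <<s G >> X Y ->
  adapted H -> (forall w, `|H w| <= M) ->
  \int[P]_w (H w * X w) = \int[P]_w (H w * Y w).
Proof.
move=> [iX _ iY XY] aH HM; have mH := adapted_measurable aH.
apply/eqP; rewrite -subr_eq0 -RintegralB//; [|exact: integrableR_mul HM iX|exact: integrableR_mul HM iY].
apply/eqP; transitivity (\int[P]_w (H w * (X w - Y w))).
  by apply: eq_Rintegral => w _; rewrite mulrBr.
apply: bounded_multiplier aH HM; first exact: integrableR_sub.
move=> A FA; rewrite RintegralB//; [|exact: Gm|exact: (integrableS measurableT (Gm FA) (@subsetT _ A) iX)|
  exact: (integrableS measurableT (Gm FA) (@subsetT _ A) iY)].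
by rewrite /Rintegral XY// subrr.
Qed.

Lemma cond_exp_bound X Y H (M s : R) : is_cond_exp P <<s G >> X Y ->
  {ae P, forall w, Y w <= s} ->
  adapted H -> (forall w, 0 <= H w <= M) ->
  \int[P]_w (H w * X w) <= s * \int[P]_w H w.
Proof.
move=> XY Ys aH H0M; have mH := adapted_measurable aH.
have HM w : `|H w| <= M by case/andP: (H0M w) => h0 h1; rewrite ger0_norm.
have iH := bounded_integrableR mH HM.
rewrite (cond_exp_multiplier XY aH HM); case: XY => _ _ iY _.
have iHY := integrableR_mul mH HM iY.
have iHs : integrableR (fun w => s * H w).
  by apply: (@integrableR_mul (fun=> s) _ `|s|).
rewrite -subr_ge0 -RintegralZl// -RintegralB//.
have iD := integrableR_sub iHs iHY.
(* The bound on [Y] holds only almost everywhere, so the integrand is replaced by its absolute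
   value, to which it is almost everywhere equal. *)
have -> : \int[P]_w (s * H w - H w * Y w) = \int[P]_w `|s * H w - H w * Y w|.
  rewrite /Rintegral; congr fine; apply: ae_eq_integral => //.
  - exact: (measurable_int _ iD).
  - exact: (measurable_int _ (integrable_norm iD)).
  apply: filterS Ys => w Yw _ /=; congr EFin; rewrite ger0_norm// subr_ge0 mulrC ler_wpM2r//.
  by case/andP: (H0M w).
exact: Rintegral_ge0.
Qed.

End ConditionalExpectation.

(** * The exponential of one noise increment, pointwise *)

Section OneStepPointwise.
Context {R : realType} {n m : nat}.
Implicit Types (g h v : 'I_m -> 'rV[R]_n).

Lemma sum_sqr_le (a : 'I_m -> R) : (\sum_i a i) ^+ 2 <= m%:R * \sum_i a i ^+ 2.
Proof.
have -> : m%:R * \sum_i a i ^+ 2 = \sum_i \sum_j (a i ^+ 2 + a j ^+ 2) / 2.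
  have e i : \sum_j (a i ^+ 2 + a j ^+ 2) / 2 = (m%:R * a i ^+ 2 + \sum_j a j ^+ 2) / 2.
    by rewrite -mulr_suml big_split /= sumr_const card_ord mulr_natl.
  rewrite [RHS](eq_bigr _ (fun i _ => e i)).
  rewrite -mulr_suml big_split /= -mulr_sumr sumr_const card_ord -[X in _ + X]mulr_natl.
  by field.
rewrite expr2 mulr_suml; apply: ler_sum => i _; rewrite mulr_sumr; apply: ler_sum => j _.
have := sqr_ge0 (a i - a j); lra.
Qed.

Definition noise_increment (lam e : R) g h v : R :=
  \sum_(i < m) - e * dotv (clip lam (g i) - h i) (v i).

(** The coefficient of the [p]-th power of the raw error. The first summand comes from the clipping
    bias, the second from the quadratic term: [18] is the [2] of [expR_le_quadratic] times the [9]
    of [clip_second_moment], and [m] comes from squaring a sum. *)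
Definition moment_weight (lam e V p : R) : R :=
  2 * e * V * lam `^ (1 - p) + 18 * m%:R * e ^+ 2 * V ^+ 2 * lam `^ (2 - p).

Variables (lam e V p : R) (g h v : 'I_m -> 'rV[R]_n).
Hypotheses (lam0 : 0 < lam) (e0 : 0 <= e) (p12 : 1 < p <= 2)
  (hl : forall i, enorm (h i) <= lam / 2) (vV : forall i, enorm (v i) <= V)
  (small : m%:R * (e * V * (3 / 2 * lam)) <= 2^-1).

Let term_le i : `|- e * dotv (clip lam (g i) - h i) (v i)| <=
   e * V * enorm (clip lam (g i) - h i).
Proof.
rewrite normrM normrN (ger0_norm e0) -mulrA ler_wpM2l//.
apply: le_trans (dotv_abs_le _ _) _; rewrite mulrC ler_wpM2r ?enorm_ge0//.
Qed.

Let V0 (i : 'I_m) : 0 <= V. Proof. exact: le_trans (enorm_ge0 _) (vV i). Qed.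

Lemma noise_increment_abs : `|noise_increment lam e g h v| <= 2^-1.
Proof.
apply: le_trans (ler_norm_sum _ _ _) _; apply: le_trans small.
apply: (@le_trans _ _ (\sum_(i < m) e * V * (3 / 2 * lam))).
  apply: ler_sum => i _; apply: le_trans (term_le i) _.
  by rewrite ler_wpM2l ?mulr_ge0 ?(V0 i)// clip_dist.
by rewrite sumr_const card_ord -[leLHS]mulr_natl.
Qed.

Lemma exp_noise_increment_le : expR (noise_increment lam e g h v) <=
  1 + \sum_(i < m) (- e * dotv (g i - h i) (v i)) +
  \sum_(i < m) moment_weight lam e V p * enorm (g i - h i) `^ p.
Proof.
have z2 : noise_increment lam e g h v <= 2^-1.
  exact: le_trans (ler_norm _) noise_increment_abs.
apply: le_trans (expR_le_quadratic z2) _.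
(* Only the bias [clip lam (g i) - g i] is estimated; the raw error stays linear, so that it can
   integrate to zero later. *)
have hlin : noise_increment lam e g h v <= \sum_(i < m) (- e * dotv (g i - h i) (v i)) +
    \sum_(i < m) 2 * e * V * lam `^ (1 - p) * enorm (g i - h i) `^ p.
  rewrite -big_split; apply: ler_sum => i _ /=.
  have -> : clip lam (g i) - h i = (clip lam (g i) - g i) + (g i - h i) by rewrite addrA subrK.
  rewrite [dotv (_ + _) _]dotvDl mulrDr.
  have h1 : - dotv (clip lam (g i) - g i) (v i) <= V * (2 * enorm (g i - h i) `^ p * lam `^ (1 - p)).
    rewrite -dotvNl; apply: le_trans (dotv_le _ _) _; rewrite enormN mulrC.
    by apply: ler_pM; rewrite ?enorm_ge0// clip_bias.
  have := ler_wpM2l e0 h1; lra.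
have hsq : noise_increment lam e g h v ^+ 2 <=
    \sum_(i < m) 9 * m%:R * e ^+ 2 * V ^+ 2 * lam `^ (2 - p) * enorm (g i - h i) `^ p.
  apply: le_trans (sum_sqr_le _) _; rewrite mulr_sumr; apply: ler_sum => i _.
  have h1 : (- e * dotv (clip lam (g i) - h i) (v i)) ^+ 2 <=
     (e * V) ^+ 2 * (9 * enorm (g i - h i) `^ p * lam `^ (2 - p)).
    rewrite -real_normK ?num_real//.
    apply: (@le_trans _ _ ((e * V * enorm (clip lam (g i) - h i)) ^+ 2)).
      by rewrite ler_pXn2r ?nnegrE ?normr_ge0 ?mulr_ge0 ?enorm_ge0 ?(V0 i)// term_le.
    by rewrite exprMn ler_wpM2l ?sqr_ge0// clip_second_moment.
  have := ler_wpM2l (ler0n R m) h1; lra.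
have -> : \sum_(i < m) moment_weight lam e V p * enorm (g i - h i) `^ p =
  \sum_(i < m) 2 * e * V * lam `^ (1 - p) * enorm (g i - h i) `^ p +
  2 * \sum_(i < m) 9 * m%:R * e ^+ 2 * V ^+ 2 * lam `^ (2 - p) * enorm (g i - h i) `^ p.
  rewrite mulr_sumr -big_split; apply: eq_bigr => i _ /=; rewrite /moment_weight; ring.
lra.
Qed.

End OneStepPointwise.

(** * One step of the exponential moment *)

Section OneStep.
Context {R : realType} {d : measure_display} {Omega : measurableType d}
  (P : probability Omega R) {n m : nat} (G : set (set Omega)).
Hypothesis Gm : <<s G >> `<=` measurable.
Variables (lam e V p s B : R) (g h v : 'I_m -> Omega -> 'rV[R]_n) (W : Omega -> R).
Hypotheses (lam0 : 0 < lam) (e0 : 0 <= e) (p12 : 1 < p <= 2)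
  (hl : forall i w, enorm (h i w) <= lam / 2) (vV : forall i w, enorm (v i w) <= V)
  (small : m%:R * (e * V * (3 / 2 * lam)) <= 2^-1)
  (gh : forall i (k : 'I_n), is_cond_exp P <<s G >> (fun w => g i w ord0 k) (fun w => h i w ord0 k))
  (ghp : forall i, exists Z : Omega -> R,
     is_cond_exp P <<s G >> (fun w => enorm (g i w - h i w) `^ p) Z /\
     {ae P, forall w, Z w <= s})
  (av : forall i k, adapted G (fun w => v i w ord0 k))
  (aW : adapted G W) (WB : forall w, `|W w| <= B)
  (mg : forall i k, measurable_fun setT (fun w => g i w ord0 k)).

Let incr w := noise_increment lam e (g^~ w) (h^~ w) (v^~ w).

Let mh i : coord_measurable (h i).
Proof. by move=> k; case: (gh i k) => _ _ iY _; exact: integrableR_measurable iY. Qed.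

Let mv i : coord_measurable (v i).
Proof. by move=> k; apply: (adapted_measurable Gm); exact: av. Qed.

Let expW_bound w : 0 <= expR (W w) <= expR B.
Proof.
rewrite expR_ge0 ler_expR; exact: le_trans (ler_norm _) (WB w).
Qed.

Let expW_abs w : `|expR (W w)| <= expR B.
Proof. by case/andP: (expW_bound w) => h1 h2; rewrite ger0_norm. Qed.

Let aexpW : adapted G (fun w => expR (W w)).
Proof. by have := measurableT_comp (@measurable_expR R) aW. Qed.

Lemma measurable_increment : measurable_fun setT incr.
Proof.
have := @measurable_sum _ Omega R setT _ (index_enum 'I_m)
  (fun i w => - e * dotv (clip lam (g i w) - h i w) (v i w)); apply => i.
apply: measurable_funM => //; apply: dotv_measurable => //.
by apply: coord_measurableB => //; apply: clip_measurable => k; exact: mg.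
Qed.

(** Conditional means are given per coordinate, so the linear part is expanded into coordinates with
    bounded adapted weights proportional to [v i w ord0 k * expR (W w)], and integrates to zero;
    [cond_exp_bound] handles the [p]-th powers. *)
Lemma exp_step : \int[P]_w expR (W w + incr w) <=
  (1 + m%:R * moment_weight (m := m) lam e V p * s) * \int[P]_w expR (W w).
Proof.
have mexpW := adapted_measurable Gm aexpW.
have iW : integrableR P (fun w => expR (W w)) by exact: bounded_integrableR expW_abs.
have av1 i k w : `|- e * (v i w ord0 k * expR (W w))| <= e * (V * expR B).
  rewrite normrM normrN (ger0_norm e0) ler_wpM2l// normrM.
  apply: ler_pM => //; apply: le_trans (vV i w).
  rewrite -(@ler_pXn2r _ 2) ?nnegrE ?normr_ge0 ?enorm_ge0// enorm_sqr real_normK ?num_real//.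
  exact: coord_sqr_le.
have aev i k : adapted G (fun w => - e * (v i w ord0 k * expR (W w))).
  by apply: measurable_funM => //; apply: measurable_funM => //; exact: av.
have ix i k : integrableR P (fun w => g i w ord0 k - h i w ord0 k).
  by case: (gh i k) => iX _ iY _; exact: integrableR_sub.
have i1 i k : integrableR P (fun w => - e * (v i w ord0 k * expR (W w)) * (g i w ord0 k - h i w ord0 k)).
  exact: (integrableR_mul (adapted_measurable Gm (aev i k)) (av1 i k) (ix i k)).
have z1 i k : \int[P]_w (- e * (v i w ord0 k * expR (W w)) * (g i w ord0 k - h i w ord0 k)) = 0.
  have := cond_exp_multiplier Gm (gh i k) (aev i k) (av1 i k).
  case: (gh i k) => iX _ iY _ E.
  under eq_Rintegral do rewrite mulrBr.
  rewrite RintegralB//; first by rewrite E subrr.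
  - exact: (integrableR_mul (adapted_measurable Gm (aev i k)) (av1 i k) iX).
  - exact: (integrableR_mul (adapted_measurable Gm (aev i k)) (av1 i k) iY).
set q := moment_weight lam e V p.
have i2' i : integrableR P (fun w => enorm (g i w - h i w) `^ p) by case: (ghp i) => Z [[]].
have i2 i : integrableR P (fun w => expR (W w) * enorm (g i w - h i w) `^ p).
  exact: (integrableR_mul mexpW expW_abs (i2' i)).
have i3 i : integrableR P (fun w => q * (expR (W w) * enorm (g i w - h i w) `^ p)).
  exact: (@integrableR_mul _ _ _ _ (fun=> q) _ `|q|).
have z2 i : \int[P]_w (expR (W w) * enorm (g i w - h i w) `^ p) <= s * \int[P]_w expR (W w).
  case: (ghp i) => Z [XZ Zs]; exact: (cond_exp_bound Gm XZ Zs aexpW expW_bound).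
have mincr := measurable_increment.
have iL : integrableR P (fun w => expR (W w + incr w)).
  apply: (@bounded_integrableR _ _ _ _ _ (expR (B + 2^-1))).
    apply: measurableT_comp => //; apply: measurable_funD => //.
    exact: (adapted_measurable Gm aW).
  move=> w; rewrite ger0_norm ?expR_ge0// ler_expR lerD//.
    exact: le_trans (ler_norm _) (WB w).
  apply: le_trans (ler_norm _) _; exact: noise_increment_abs.
pose S1 w := \sum_(i < m) \sum_(k < n) (- e * (v i w ord0 k * expR (W w)) * (g i w ord0 k - h i w ord0 k)).
pose S2 w := \sum_(i < m) (q * (expR (W w) * enorm (g i w - h i w) `^ p)).
have iS1 : integrableR P S1 by apply: integrableR_sum => i; exact: integrableR_sum.
have iS2 : integrableR P S2 by exact: integrableR_sum.
apply: (@le_trans _ _ (\int[P]_w (expR (W w) + S1 w + S2 w))).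
  apply: le_Rintegral => //.
    by apply: integrableR_add => //; exact: integrableR_add.
  move=> w _; rewrite expRD.
  have := exp_noise_increment_le (g^~ w) lam0 e0 p12 (hl^~ w) (vV^~ w) small.
  rewrite -/(incr w) -/q => hh.
  have := ler_wpM2l (expR_ge0 (W w)) hh; rewrite !mulrDr mulr1 => /le_trans; apply.
  rewrite -!addrA lerD2l le_eqVlt; apply/orP; left; apply/eqP; congr (_ + _).
    rewrite mulr_sumr; apply: eq_bigr => i _; rewrite /dotv !mulr_sumr.
    by apply: eq_bigr => k _; rewrite !mxE; ring.
  by rewrite mulr_sumr; apply: eq_bigr => i _; ring.
rewrite RintegralD//; last exact: integrableR_add.
rewrite RintegralD//.
have -> : \int[P]_w S1 w = 0.
  rewrite Rintegral_bigsum; last by move=> i; exact: integrableR_sum.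
  by apply: big1 => i _; rewrite Rintegral_bigsum//; apply: big1 => k _.
rewrite addr0 mulrDl mul1r lerD2l Rintegral_bigsum//.
(* Nonnegativity of [V] is read off the norm of some agent's vector, hence the condition on [m]; it
   is met inside the sum over agents. *)
have q0 : (0 < m)%N -> 0 <= q.
  move=> m0; have V0 : 0 <= V by apply: le_trans (vV (Ordinal m0) point); exact: enorm_ge0.
  by rewrite addr_ge0// !mulr_ge0 ?powR_ge0 ?sqr_ge0.
apply: (@le_trans _ _ (\sum_(i < m) q * (s * \int[P]_w expR (W w)))).
  apply: ler_sum => i _; have -> : \int[P]_w (q * (expR (W w) * enorm (g i w - h i w) `^ p)) =
    q * \int[P]_w (expR (W w) * enorm (g i w - h i w) `^ p) by have := RintegralZl q measurableT (i2 i).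
  apply: ler_wpM2l; last exact: z2. apply: q0.
  exact: leq_ltn_trans (ltn_ord i).
by rewrite sumr_const card_ord -[leLHS]mulr_natl !mulrA.
Qed.

End OneStep.

(** * Maximal tail bound for a frozen process *)

Section TailBound.
Context {R : realType} {d : measure_display} {Omega : measurableType d}
  (P : probability Omega R) (W : nat -> Omega -> R) (b : nat -> R) (S delta : R).
Hypotheses (d01 : 0 < delta < 1) (mW : forall t, measurable_fun setT (W t))
  (bW : forall t, exists B : R, forall w, `|W t w| <= B)
  (W0 : forall w, W 0 w = 0) (b0 : forall t, 0 <= b t)
  (bS : forall T, \sum_(0 <= t < T) b t <= S)
  (step : forall t, \int[P]_w expR (W t.+1 w) <= (1 + b t) * \int[P]_w expR (W t w))
  (stop : forall t w, ln delta^-1 + S <= W t w -> W t.+1 w = W t w).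

Let K := ln delta^-1 + S.
Let A t : set Omega := [set w | K <= W t w].

Let exp_moment T : \int[P]_w expR (W T w) <= expR (\sum_(0 <= t < T) b t).
Proof.
elim: T => [|T IH].
  rewrite big_geq// expR0; under eq_Rintegral do rewrite W0 expR0.
  rewrite Rintegral_cst// mul1r -lee_fin fineK ?fin_num_measure//; exact: probability_le1.
rewrite big_nat_recr//= addrC expRD; apply: le_trans (step T) _.
apply: ler_pM => //; first by rewrite addr_ge0.
  by apply: Rintegral_ge0 => w _; exact: expR_ge0.
exact: expR_ge1Dx.
Qed.

Let iexp T : integrableR P (fun w => expR (W T w)).
Proof.
have [B HB] := bW T; apply: (@bounded_integrableR _ _ _ _ _ (expR B)).
  by apply: measurableT_comp.
by move=> w; rewrite ger0_norm ?expR_ge0// ler_expR (le_trans (ler_norm _)).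
Qed.

Let mA T : measurable (A T).
Proof.
have := measurable_fun_le measurableT (@measurable_cst _ _ _ _ setT K) (mW T).
by rewrite setTI.
Qed.

(* Freezing [W] above [K] makes the events [K <= W t] increasing in [t], so that Markov's
   inequality at time [T] controls all times up to [T]. *)
Let tail T : (P (A T) <= delta%:E)%E.
Proof.
have [d0 d1] := andP d01.
have fA : P (A T) \is a fin_num by exact: fin_num_measure.
rewrite -(fineK fA) lee_fin.
have h1 : expR K * fine (P (A T)) <= \int[P]_w expR (W T w).
  rewrite -Rintegral_cst ?mA// Rintegral_mkcond; apply: le_Rintegral => //; [|exact: iexp|].
    apply: (@bounded_integrableR _ _ _ _ _ (expR K)).
      by apply/(measurable_restrict _ (mA T) measurableT); exact: measurable_cst.
    move=> w; rewrite patchE; case: ifP => _; first by rewrite ger0_norm ?expR_ge0.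
    by rewrite normr0 expR_ge0.
  move=> w _; rewrite patchE; case: ifPn; last by rewrite expR_ge0.
  by rewrite inE /A/= ler_expR.
have h2 : \int[P]_w expR (W T w) <= expR S.
  by apply: le_trans (exp_moment T) _; rewrite ler_expR.
have eK : expR K = delta^-1 * expR S by rewrite /K expRD lnK// posrE invr_gt0.
have := le_trans h1 h2; rewrite eK mulrAC -ler_pdivlMr ?expR_gt0// divff ?gt_eqF ?expR_gt0//.
by rewrite -[X in X * _ <= _]div1r mulrAC ler_pdivrMr// !mul1r.
Qed.

(** The events [A t] increase, so continuity from below transfers the bound to their union; its
    complement is a single event valid for all times at once. *)
Lemma stopped_tail_bound : exists E : set Omega, measurable E /\
  ((1 - delta)%:E <= P E)%E /\ forall w, E w -> forall t, W t w < K.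
Proof.
have mAA : measurable (\bigcup_t A t) by exact: bigcupT_measurable.
have PA : (P (\bigcup_t A t) <= delta%:E)%E.
  have nd : nondecreasing_seq A.
    apply/nondecreasing_seqP => t; rewrite subsetEset => w h.
    by rewrite /A /= (stop h).
  have hc := @nondecreasing_cvg_mu _ _ _ P _ mA mAA nd.
  rewrite -(cvg_lim _ hc)//; apply: lime_le; first exact: cvgP hc.
  by apply: nearW => t; exact: tail.
exists (~` (\bigcup_t A t)); split; first exact: measurableC; split.
  rewrite probability_setC// EFinB leeB//.
move=> w /= nA t; rewrite ltNge; apply/negP => h; apply: nA; by exists t.
Qed.

End TailBound.

(** The term [6 * m * M * K] is the noise, whose process is scaled by [1 / (6 m M)]. The factor [10]
    leaves [M^2 - 6 m M A = m^2 (R1^2 + 14 R1 A + 40 A^2)], which covers the initial divergence and,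
    as [m C1 <= A / 2], the step and consensus terms. *)
Lemma radius_dominates (R : realType) (m Per R1 A K C1 D1 S1 S2 M : R) :
  1 <= m -> 1 <= Per -> 0 <= R1 -> 0 <= C1 -> K <= A -> 8 <= A ->
  2 * m * Per * C1 <= A -> D1 <= m * (R1 ^+ 2 / 2) -> S1 <= C1 -> S2 <= C1 ->
  M = m * (R1 + 10 * A) ->
  D1 + m / 2 * S2 + m * (Per + R1) * S1 + 6 * m * M * K <= M ^+ 2.
Proof.
move=> m1 P1 R0 C0 KA A8 CA D1b S1b S2b ME.
have M0 : 0 <= M by rewrite ME mulr_ge0; lra.
have mC : 0 <= m * C1 by rewrite mulr_ge0; lra.
have mP : m * C1 <= m * Per * C1.
  by rewrite -subr_ge0 (_ : _ - _ = (Per - 1) * (m * C1)); [rewrite mulr_ge0; lra|ring].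
have h1 : 6 * m * M * K <= 6 * m * M * A by rewrite ler_wpM2l// !mulr_ge0; lra.
have h2 : m / 2 * S2 <= m / 2 * C1 by rewrite ler_wpM2l; lra.
have h3 : m * (Per + R1) * S1 <= m * (Per + R1) * C1.
  by rewrite ler_wpM2l// mulr_ge0; lra.
have h4 : R1 * (m * C1) <= R1 * (A / 2) by rewrite ler_wpM2l; lra.
have h5 : M ^+ 2 - 6 * m * M * A = m ^+ 2 * (R1 ^+ 2 + 14 * R1 * A + 40 * A ^+ 2).
  by rewrite ME; ring.
have RA : 0 <= R1 * A by rewrite mulr_ge0; lra.
have AA : A <= A ^+ 2 by rewrite expr2 ler_peMl; lra.
have Q0 : 0 <= R1 ^+ 2 + 14 * R1 * A + 40 * A ^+ 2 by have := sqr_ge0 R1; have := sqr_ge0 A; lra.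
have h6 : m * (R1 ^+ 2 + 14 * R1 * A + 40 * A ^+ 2) <= m ^+ 2 * (R1 ^+ 2 + 14 * R1 * A + 40 * A ^+ 2).
  by rewrite ler_wpM2r// expr2 ler_peMl; lra.
have h7 : 14 * R1 * A + 40 * A ^+ 2 <= m * (14 * R1 * A + 40 * A ^+ 2).
  by rewrite ler_peMl//; have := sqr_ge0 A; lra.
have h8 : 0 <= m * R1 ^+ 2 by rewrite mulr_ge0 ?sqr_ge0; lra.
lra.
Qed.

(** * Adaptedness of the iterates *)

Section Adaptedness.
Context {R : realType} {d : measure_display} {Omega : measurableType d} {n m : nat}
  (g : 'I_m -> nat -> Omega -> 'rV[R]_n).
Hypothesis mg : forall i t (k : 'I_n), measurable_fun setT (fun w => g i t w ord0 k).

(** The generators of [gen_filtration g t] without the closure: [adapted] and the lemmas on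
    conditional expectation are parametrized by a generating family. *)
Definition observed t : set (set Omega) :=
  [set A | exists (j : 'I_m) (s : nat) (k : 'I_n) (B : set R),
    [/\ (1 <= s <= t)%N, measurable B & A = (fun w => g j s w ord0 k) @^-1` B]].

Lemma observed_measurable t : <<s observed t >> `<=` measurable.
Proof.
apply: smallest_sub; first exact: sigma_algebra_measurable.
move=> _ [j [s [k [B [_ mB ->]]]]]; rewrite -[X in measurable X]setTI.
exact: mg.
Qed.

Lemma adapted_mono s t (H : Omega -> R) : (s <= t)%N ->
  adapted (observed s) H -> adapted (observed t) H.
Proof.
move=> st aH _ B mB; apply: (@sub_sigma_algebra2 _ setT (observed t) (observed s)).
  move=> _ [j [r [k [C [/andP[r1 rs] mC ->]]]]]; exists j, r, k, C; split => //.
  by rewrite r1 (leq_trans rs).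
exact: (aH measurableT B mB).
Qed.

Lemma observation_adapted i s t k : (0 < s)%N -> (s <= t)%N ->
  adapted (observed t) (fun w => g i s w ord0 k).
Proof.
move=> s0 st _ B mB; rewrite setTI; apply: sub_sigma_algebra.
by exists i, s, k, B; split => //; rewrite s0.
Qed.

Definition coord_adapted t (x : Omega -> 'rV[R]_n) :=
  forall k, adapted (observed t) (fun w => x w ord0 k).

(** The iterate with index [t + 1] uses observations up to [t] only. The base case is the
    deterministic start; the inductive step is [mirror_step_measurable] over the sigma-algebra of
    the observations. *)
Lemma iterates_adapted (X : set 'rV[R]_n) (Phi : 'rV[R]_n -> R) gPhi Per
    (al la : nat -> R) (x1 : 'I_m -> 'rV[R]_n) (x y : 'I_m -> nat -> Omega -> 'rV[R]_n) :
  convex_set X -> gradient_on X Phi gPhi ->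
  (forall u v, X u -> X v ->
     dotv (gPhi v) (u - v) + 2^-1 * enorm (u - v) ^+ 2 <= Phi u - Phi v) ->
  (forall t, (0 < t)%N -> 0 < al t) ->
  (forall i w, x i 1%N w = x1 i) ->
  (forall i t w, (0 < t)%N -> X (x i t w)) ->
  (forall i t w, (0 < t)%N -> X (y i t.+1 w)) ->
  (forall i t w z, (0 < t)%N -> X z ->
    0 <= dotv (al t *: clip (la t) (g i t w) + gPhi (y i t.+1 w) - gPhi (x i t w)) (z - y i t.+1 w)) ->
  (forall i t w, (0 < t)%N -> x i t.+1 w = if comm_instant Per t.+1
     then m%:R^-1 *: \sum_(j < m) y j t.+1 w else y i t.+1 w) ->
  forall t i, coord_adapted t (x i t.+1).
Proof.
move=> cX gr sc al0 xx1 Xx Xy opt xy; elim=> [|t IH] i.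
  rewrite (_ : x i 1%N = fun=> x1 i); last by apply/funext => w; rewrite xx1.
  by move=> k; exact: measurable_cst.
have ay j : coord_adapted t.+1 (y j t.+2).
  apply: (@mirror_step_measurable _ _ _ (g_sigma_algebraType (observed t.+1)) X Phi gPhi
    (al t.+1) (fun w => clip (la t.+1) (g j t.+1 w)) (x j t.+1) (y j t.+2)) => //.
  - exact: al0.
  - by move=> w; exact: Xx.
  - by move=> w; exact: Xy.
  - by move=> w z Xz; exact: opt.
  - by apply: clip_measurable => k; exact: observation_adapted.
  - by move=> k; apply: adapted_mono (IH j k).
rewrite (_ : x i t.+2 = if comm_instant Per t.+2
     then (fun w => m%:R^-1 *: \sum_(j < m) y j t.+2 w) else y i t.+2).
  case: ifP => _; last exact: ay.
  apply: (@coord_measurableZ _ _ _ (g_sigma_algebraType (observed t.+1)) (fun=> m%:R^-1)) => //.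
  exact: (@coord_measurable_sum _ _ _ (g_sigma_algebraType (observed t.+1))).
by apply/funext => w; rewrite xy//; case: ifP.
Qed.

End Adaptedness.

(** * The truncated and frozen noise *)

Section StoppedNoise.
Context {R : realType} {n m : nat} (gf : 'I_m -> 'rV[R]_n -> 'rV[R]_n) (xstar : 'rV[R]_n)
  (K M eta : R) (al la : nat -> R) (g x : 'I_m -> nat -> 'rV[R]_n).

(* With value [0] the increment vanishes: this implements both the truncation at distance
   [2 M] and the freezing at level [K]. *)
Definition truncated (W : R) (z : 'rV[R]_n) : 'rV[R]_n :=
  if (W < K) && (enorm (z - xstar) <= 2 * M) then z - xstar else 0.

(** The direction paired with the error at step [s.+1] is gated by the value at [s], so it is known
    before that gradient is sampled. *)
Fixpoint stopped_noise (t : nat) : R :=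
  if t is s.+1 then stopped_noise s +
    noise_increment (la t) (eta * al t) (g^~ t) (fun i => gf i (x i t))
      (fun i => truncated (stopped_noise s) (x i t))
  else 0.

Lemma truncated_norm W z : 0 <= M -> enorm (truncated W z) <= 2 * M.
Proof.
move=> M0; rewrite /truncated; case: ifP => [/andP[]//|_].
by rewrite enorm0 mulr_ge0.
Qed.

Lemma stopped_noise_stop t : K <= stopped_noise t -> stopped_noise t.+1 = stopped_noise t.
Proof.
move=> h /=; rewrite /noise_increment big1 ?addr0// => i _.
rewrite /truncated ltNge h /= -(scale0r (0 : 'rV[R]_n)).
by rewrite dotvZr mul0r mulr0.
Qed.

Lemma stopped_noise_running T :
  (forall t, stopped_noise t < K) ->
  (forall t i, (0 < t <= T)%N -> enorm (x i t - xstar) <= 2 * M) ->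
  stopped_noise T = eta * \sum_(1 <= t < T.+1)
    noise gf xstar x (fun i t => clip (la t) (g i t)) al t.
Proof.
move=> SK; elim: T => [|T IH] xM; first by rewrite big_geq// mulr0.
rewrite big_nat_recr//= mulrDr IH; last first.
  by move=> t i /andP[t0 tT]; apply: xM; rewrite t0 leqW.
congr (_ + _); rewrite -IH; last by move=> t i /andP[t0 tT]; apply: xM; rewrite t0 leqW.
rewrite /noise /noise_increment mulr_sumr; apply: eq_bigr => i _.
by rewrite /truncated SK xM ?leqnn// mulrA mulrN.
Qed.

End StoppedNoise.

(** * Adaptedness and tail of the stopped noise *)

Section StoppedNoiseProcess.
Context {R : realType} {d : measure_display} {Omega : measurableType d} {n m : nat}
  (P : probability Omega R) (g x : 'I_m -> nat -> Omega -> 'rV[R]_n)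
  (gf : 'I_m -> 'rV[R]_n -> 'rV[R]_n) (xstar : 'rV[R]_n)
  (K M eta p s : R) (al la : nat -> R).
Hypotheses (M0 : 0 <= M) (eta0 : 0 <= eta) (p12 : 1 < p <= 2)
  (al0 : forall t, (0 < t)%N -> 0 <= al t) (la0 : forall t, 0 < la t)
  (gfla : forall i t w, (0 < t)%N -> enorm (gf i (x i t w)) <= la t / 2)
  (small : forall t, (0 < t)%N -> m%:R * (eta * al t * (2 * M) * (3 / 2 * la t)) <= 2^-1)
  (mg : forall i t (k : 'I_n), measurable_fun setT (fun w => g i t w ord0 k))
  (ax : forall t i, coord_adapted g t (x i t.+1))
  (unbiased : forall i t (k : 'I_n), is_cond_exp P <<s observed g t >>
     (fun w => g i t.+1 w ord0 k) (fun w => gf i (x i t.+1 w) ord0 k))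
  (moment : forall i t, exists Z : Omega -> R,
     is_cond_exp P <<s observed g t >>
        (fun w => enorm (g i t.+1 w - gf i (x i t.+1 w)) `^ p) Z /\
     {ae P, forall w, Z w <= s}).

Definition noise_process t w :=
  stopped_noise gf xstar K M eta al la (fun i t => g i t w) (fun i t => x i t w) t.

Let truncated_measurable dT (T : measurableType dT) (W : T -> R) (z : T -> 'rV[R]_n) :
  measurable_fun setT W -> coord_measurable z ->
  coord_measurable (fun w => truncated xstar K M (W w) (z w)).
Proof.
move=> mW mz k.
have mzx : coord_measurable (fun w => z w - xstar).
  by apply: coord_measurableB => //; exact: coord_measurable_cst.
rewrite (_ : (fun w => _) = (fun w => if (W w < K) && (enorm (z w - xstar) <= 2 * M)
    then (z w - xstar) ord0 k else 0)).
  apply: measurable_fun_ifT => //.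
  apply: measurable_and; first exact: measurable_fun_ltr.
  by apply: measurable_fun_ler => //; exact: enorm_measurable.
by apply/funext => w; rewrite /truncated; case: ifP => //; rewrite mxE.
Qed.

(** Read off (A1): a conditional expectation is measurable for the conditioning sigma-algebra, and
    the gradient at the iterate is assumed to be one. *)
Let gradient_adapted i t : coord_adapted g t (fun w => gf i (x i t.+1 w)).
Proof. by move=> k _ B mB; rewrite setTI; case: (unbiased i t k) => _ + _ _; apply. Qed.

Let truncated_adapted i t : adapted (observed g t) (noise_process t) ->
  coord_adapted g t (fun w => truncated xstar K M (noise_process t w) (x i t.+1 w)).
Proof.
move=> aW; apply: (@truncated_measurable _ (g_sigma_algebraType (observed g t))) => //.
exact: ax.
Qed.

Lemma noise_process_adapted t : adapted (observed g t) (noise_process t).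
Proof.
elim: t => [|t IH]; first exact: measurable_cst.
apply: (@measurable_funD _ (g_sigma_algebraType (observed g t.+1))).
  exact: (adapted_mono (leqnSn t) IH).
have := @measurable_sum _ (g_sigma_algebraType (observed g t.+1)) R setT _ (index_enum 'I_m)
  (fun i w => - (eta * al t.+1) * dotv (clip (la t.+1) (g i t.+1 w) - gf i (x i t.+1 w))
     (truncated xstar K M (noise_process t w) (x i t.+1 w))); apply => i.
apply: (@measurable_funM _ (g_sigma_algebraType (observed g t.+1))) => //.
apply: (@dotv_measurable _ _ _ (g_sigma_algebraType (observed g t.+1))).
  apply: (@coord_measurableB _ _ _ (g_sigma_algebraType (observed g t.+1))).
    apply: (@clip_measurable _ _ _ (g_sigma_algebraType (observed g t.+1))) => k.
    exact: observation_adapted.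
  by move=> k; exact: (adapted_mono (leqnSn t) (@gradient_adapted i t k)).
by move=> k; exact: (adapted_mono (leqnSn t) (@truncated_adapted i t IH k)).
Qed.

Let increment_abs t w : `|noise_increment (la t.+1) (eta * al t.+1) (fun i => g i t.+1 w)
   (fun i => gf i (x i t.+1 w))
   (fun i => truncated xstar K M (noise_process t w) (x i t.+1 w))| <= 2^-1.
Proof.
apply: (@noise_increment_abs _ _ _ (la t.+1) (eta * al t.+1) (2 * M)) => //.
- by rewrite mulr_ge0 ?al0.
- by move=> i; exact: gfla.
- by move=> i; exact: truncated_norm.
- exact: small.
Qed.

Lemma noise_process_bounded t w : `|noise_process t w| <= t%:R / 2.
Proof.
elim: t => [|t IH]; first by rewrite normr0 mul0r.
apply: le_trans (ler_normD _ _) _; rewrite -natr1 mulrDl lerD//.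
by rewrite mul1r; exact: increment_abs.
Qed.

Lemma noise_process_step t : \int[P]_w expR (noise_process t.+1 w) <=
  (1 + m%:R * moment_weight (m := m) (la t.+1) (eta * al t.+1) (2 * M) p * s) *
    \int[P]_w expR (noise_process t w).
Proof.
apply: (@exp_step _ _ _ P n m (observed g t) (observed_measurable mg (t := t)) (la t.+1)
  (eta * al t.+1) (2 * M) p s (t%:R / 2) (fun i => g i t.+1) (fun i w => gf i (x i t.+1 w))
  (fun i w => truncated xstar K M (noise_process t w) (x i t.+1 w)) (noise_process t)) => //.
- by rewrite mulr_ge0 ?al0.
- by move=> i w; exact: gfla.
- by move=> i w; exact: truncated_norm.
- exact: small.
- by move=> i k; apply: truncated_adapted; exact: noise_process_adapted.
- exact: noise_process_adapted.
- exact: noise_process_bounded.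
Qed.

Lemma noise_process_tail (S delta : R) : 0 < delta < 1 -> K = ln delta^-1 + S -> 0 <= s ->
  (0 < m)%N ->
  (forall T, \sum_(0 <= t < T)
     m%:R * moment_weight (m := m) (la t.+1) (eta * al t.+1) (2 * M) p * s <= S) ->
  exists E : set Omega, measurable E /\ ((1 - delta)%:E <= P E)%E /\
    forall w, E w -> forall t, noise_process t w < K.
Proof.
move=> d01 KE s0 m0 bS.
have := @stopped_tail_bound _ _ _ P noise_process
  (fun t => m%:R * moment_weight (m := m) (la t.+1) (eta * al t.+1) (2 * M) p * s) S delta d01.
rewrite -KE; apply => //.
- move=> t; apply: (adapted_measurable (observed_measurable mg (t := t))).
  exact: noise_process_adapted.
- by move=> t; exists (t%:R / 2) => w; exact: noise_process_bounded.
- move=> t; rewrite !mulr_ge0// addr_ge0// !mulr_ge0 ?powR_ge0 ?sqr_ge0 ?al0//.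
- exact: noise_process_step.
- by move=> t w h; exact: stopped_noise_stop.
Qed.

End StoppedNoiseProcess.

(** With the scale [1 / (6 m M)] and the radius [2 M], both [m] and [M] cancel. Hence the level [K]
    does not depend on the radius, and defining [M] from [A >= K] is not circular. *)
Lemma moment_weight_scaled (R : realType) (m : nat) (la al M p s : R) : (0 < m)%N -> 0 < M ->
  0 < la ->
  m%:R * moment_weight (m := m) la ((6 * m%:R * M)^-1 * al) (2 * M) p * s =
  s * (2 / 3 * (al * la `^ (1 - p)) + 2 * ((al * la) ^+ 2 * la `^ (- p))).
Proof.
move=> m0 M0 la0; have mR : m%:R != 0 :> R by rewrite pnatr_eq0 -lt0n.
rewrite /moment_weight.
have -> : la `^ (2 - p) = la ^+ 2 * la `^ (- p).
  by rewrite powRD ?(gt_eqF la0) ?implybT// powR_mulrn// ltW.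
field.
by rewrite mR gt_eqF.
Qed.

(** Extracts from [A] what the radius argument uses: the summands are nonnegative, those in [C2] and
    [C4] dominate [s * (C2 + 2 * C4)], and [8 m >= 8]. *)
Lemma confidence_constant_bounds (R : realDomainType) (m Per L s s2 C1 C2 C3 C4 C5 : R) :
  1 <= m -> 1 <= Per -> 0 <= L -> 0 <= s -> 0 <= s2 ->
  0 <= C1 -> 0 <= C2 -> 0 <= C3 -> 0 <= C4 -> 0 <= C5 ->
  let A := L + 2 * m * Per * C1 + 4 * s * C2 + 16 * m * s2 * C3
    + 40 * m * s * (1 + 3 * m) * C4 + 40 * m ^+ 2 * s * C5 + 8 * m in
  [/\ L + s * (C2 + 2 * C4) <= A, 8 <= A & 2 * m * Per * C1 <= A].
Proof.
move=> m1 P1 L0 s0 s20 C10 C20 C30 C40 C50 A.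
have t1 : 0 <= m * Per * C1 by rewrite !mulr_ge0//; lra.
have t2 : 0 <= s * C2 by rewrite mulr_ge0.
have t3 : 0 <= m * s2 * C3 by rewrite !mulr_ge0//; lra.
have t4 : 0 <= s * C4 by rewrite mulr_ge0.
have t4m : s * C4 <= m * (s * C4) by rewrite ler_peMl.
have t4mm : 0 <= m ^+ 2 * (s * C4) by rewrite mulr_ge0 ?sqr_ge0.
have m0 : 0 <= m by apply: le_trans m1.
have t5 : 0 <= m ^+ 2 * s * C5 by rewrite !mulr_ge0.
by rewrite /A; split; lra.
Qed.

(** * Assembly of the high-probability bound *)

Theorem theorem4 (R : realType) (d : measure_display) (Omega : measurableType d)
  (P : probability Omega R) (n m : nat)
  (X : set 'rV[R]_n) (f : 'I_m -> 'rV[R]_n -> R) (gf : 'I_m -> 'rV[R]_n -> 'rV[R]_n)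
  (xstar : 'rV[R]_n) (Phi : 'rV[R]_n -> R) (gPhi : 'rV[R]_n -> 'rV[R]_n)
  (Per : nat) (g x y : 'I_m -> nat -> Omega -> 'rV[R]_n) (x1 : 'I_m -> 'rV[R]_n)
  (sigma p G delta kappa mu gamma R1 : R) (l : 'I_m) :
  (* setting *)
  closed X -> convex_set X ->
  (forall i, convex_on X (f i)) -> (forall i, gradient_on X (f i) (gf i)) ->
  X xstar -> (forall z, X z -> \sum_(i < m) f i xstar <= \sum_(i < m) f i z) ->
  gradient_on X Phi gPhi ->
  (forall u v, X u -> X v ->
     dotv (gPhi v) (u - v) + 2^-1 * enorm (u - v) ^+ 2 <= Phi u - Phi v) ->
  (* (A3) *)
  (forall z (ys : 'I_m -> 'rV[R]_n) (a : 'I_m -> R), X z -> (forall j, X (ys j)) ->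
     (forall j, 0 <= a j) -> \sum_(j < m) a j = 1 ->
     bregman Phi gPhi z (\sum_(j < m) a j *: ys j)
       <= \sum_(j < m) a j * bregman Phi gPhi z (ys j)) ->
  (* (A4) *)
  0 < G -> (forall i z, X z -> enorm (gf i z) <= G) ->
  (* parameters *)
  0 < sigma -> 1 < p <= 2 -> 0 < delta < 1 -> 0 < kappa < 1 -> 0 < mu < 1 ->
  Num.max (mu + 2^-1) (1 - mu * (p - 1)) <= kappa -> 1 < gamma ->
  (0 < Per)%N ->
  (* Clipped FedSMD iterates *)
  (forall i, X (x1 i)) ->
  (forall i w, x i 1%N w = x1 i) ->
  (forall i t w, (1 <= t)%N ->
     X (y i t.+1 w) /\
     forall z, X z ->
       dotv (clip (lambda G mu t) (g i t w)) (y i t.+1 w)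
         + (alpha G kappa mu gamma t)^-1 * bregman Phi gPhi (y i t.+1 w) (x i t w)
       <= dotv (clip (lambda G mu t) (g i t w)) z
         + (alpha G kappa mu gamma t)^-1 * bregman Phi gPhi z (x i t w)) ->
  (forall i t w, (1 <= t)%N ->
     x i t.+1 w = if comm_instant Per t.+1
                  then m%:R^-1 *: \sum_(j < m) y j t.+1 w
                  else y i t.+1 w) ->
  (* (A1) *)
  (forall i t (k : 'I_n), measurable_fun setT (fun w => g i t w ord0 k)) ->
  (forall i t (k : 'I_n), (1 <= t)%N ->
     is_cond_exp P (gen_filtration g t.-1)
       (fun w => g i t w ord0 k) (fun w => gf i (x i t w) ord0 k)) ->
  (forall i t, (1 <= t)%N ->
     exists Z : Omega -> R,
       is_cond_exp P (gen_filtration g t.-1)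
         (fun w => enorm (g i t w - gf i (x i t w)) `^ p) Z /\
       {ae P, forall w, Z w <= sigma `^ p}) ->
  (* R_1 *)
  (forall i, Num.sqrt (2 * bregman Phi gPhi xstar (x1 i)) <= R1) ->
  let al := alpha G kappa mu gamma in
  let la := lambda G mu in
  let C1 := sum_from1 (fun t => al t * al (tau Per t) * la t * la (tau Per t)) in
  let C2 := sum_from1 (fun t => al t * la t `^ (1 - p)) in
  let C3 := sum_from1 (fun t => al t ^+ 2 * la t `^ (2 - 2 * p)) in
  let C4 := sum_from1 (fun t => (al t * la t) ^+ 2 * la t `^ (- p)) in
  let C5 := sum_from1 (fun t => (al t * la t) ^+ 4 * la t `^ (- p)) in
  let A := ln delta^-1 + 2 * m%:R * Per%:R * C1 + 4 * sigma `^ p * C2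
           + 16 * m%:R * sigma `^ (2 * p) * C3
           + 40 * m%:R * sigma `^ p * (1 + 3 * m%:R) * C4
           + 40 * m%:R ^+ 2 * sigma `^ p * C5 + 8 * m%:R in
  exists E : set Omega, measurable E /\ ((1 - delta)%:E <= P E)%E /\
    forall w, E w -> forall T : nat, (1 <= T)%N ->
      \sum_(i < m) f i (T%:R^-1 *: \sum_(1 <= t < T.+1) x l t w)
        - \sum_(i < m) f i xstar
      <= (T%:R * al T)^-1 * (m%:R ^+ 2 * (R1 + 10 * A) ^+ 2).
Proof.
move=> clX cX cf gradf Xstar fmin gradPhi sc A3 G0 gfG sigma0 p12 d01 k01 mu01 hk gamma1 Per0
  Xx1 xx1 ymin xy mg unbiased moment R1P al la C1 C2 C3 C4 C5 A.
have m0 : (0 < m)%N by exact: leq_ltn_trans (ltn_ord l).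
have mR1 : 1 <= m%:R :> R by rewrite ler1n.
have PR1 : 1 <= Per%:R :> R by rewrite ler1n.
have [d0 d1] := andP d01.
have al0 t : (0 < t)%N -> 0 < al t by exact: (alpha_gt0 G0 p12 mu01 hk gamma1).
have la0 t : 0 < la t by exact: lambda_gt0.
have ala t : (0 < t)%N -> al t * la t = step_bound kappa mu gamma t
  by exact: (alpha_lambda G0 p12 mu01 hk gamma1).
have Xx i t w : (0 < t)%N -> X (x i t w).
  move=> t0; apply: (@iterate_in _ _ _ X Per (fun i t => x i t w) (fun i t => y i t w) cX) => //.
  - by move=> j; rewrite xx1.
  - by move=> j r r0; case: (ymin j r w r0).
  - by move=> j r r0; exact: xy.
have opt i t w z : (0 < t)%N -> X z ->
    0 <= dotv (al t *: clip (la t) (g i t w) + gPhi (y i t.+1 w) - gPhi (x i t w)) (z - y i t.+1 w).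
  by move=> t0 Xz; case: (ymin i t w t0) => Xy ym; apply: (mirror_optimality cX gradPhi (al0 _ t0) Xy ym Xz).
have Xy i t w : (0 < t)%N -> X (y i t.+1 w) by move=> t0; case: (ymin i t w t0).
have ax : forall t i, coord_adapted g t (x i t.+1).
  by apply: (@iterates_adapted _ _ _ _ _ g X Phi gPhi Per al la x1 x y).
pose aa t := al t * la t.
have c1_ge0 t : (0 < t)%N -> 0 <= al t * al (tau Per t) * la t * la (tau Per t).
  exact: (C1_ge0 Per G0 p12 mu01 hk gamma1).
have C1b := C1_bound G0 p12 mu01 hk gamma1 Per0.
have C2b := C2_bound G0 p12 mu01 hk gamma1.
have C3b := C3_bound G0 p12 mu01 hk gamma1.
have C4b := C4_bound G0 p12 mu01 hk gamma1.
have C5b := C5_bound G0 p12 mu01 hk gamma1.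
have c2_ge0 t : (0 < t)%N -> 0 <= al t * la t `^ (1 - p).
  by move=> t0; rewrite mulr_ge0 ?powR_ge0// ltW// al0.
have c3_ge0 t : (0 < t)%N -> 0 <= al t ^+ 2 * la t `^ (2 - 2 * p).
  by move=> t0; rewrite mulr_ge0 ?powR_ge0// sqr_ge0.
have c4_ge0 t : (0 < t)%N -> 0 <= (al t * la t) ^+ 2 * la t `^ (- p).
  by move=> t0; rewrite mulr_ge0 ?powR_ge0// sqr_ge0.
have c5_ge0 t : (0 < t)%N -> 0 <= (al t * la t) ^+ 4 * la t `^ (- p).
  by move=> t0; rewrite mulr_ge0 ?powR_ge0// ala// exprn_ge0// step_bound_ge0.
have C10 : 0 <= C1 := sum_from1_ge0 c1_ge0 C1b.
have C20 : 0 <= C2 := sum_from1_ge0 c2_ge0 C2b.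
have C30 : 0 <= C3 := sum_from1_ge0 c3_ge0 C3b.
have C40 : 0 <= C4 := sum_from1_ge0 c4_ge0 C4b.
have C50 : 0 <= C5 := sum_from1_ge0 c5_ge0 C5b.
have C1ub := sum_from1_ub c1_ge0 C1b.
have C2ub := sum_from1_ub c2_ge0 C2b.
have C4ub := sum_from1_ub c4_ge0 C4b.
rewrite -/C1 in C1ub; rewrite -/C2 in C2ub; rewrite -/C4 in C4ub.
have ldelta : 0 <= ln delta^-1.
  by apply: ln_ge0; rewrite invf_ge1// ltW.
pose s := sigma `^ p; have s0 : 0 <= s by exact: powR_ge0.
pose S := s * (C2 + 2 * C4); pose K := ln delta^-1 + S.
have [KA A8 CA] : [/\ K <= A, 8 <= A & 2 * m%:R * Per%:R * C1 <= A].
  apply: (@confidence_constant_bounds R m%:R Per%:R (ln delta^-1) s (sigma `^ (2 * p))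
    C1 C2 C3 C4 C5) => //; exact: powR_ge0.
clearbody A C1 C2 C3 C4 C5.
have R10 : 0 <= R1 by apply: le_trans (R1P l); rewrite sqrtr_ge0.
have [M ME] : exists M : R, M = m%:R * (R1 + 10 * A) by eexists.
have M0 : 0 < M.
  by rewrite ME; apply: mulr_gt0; [rewrite ltr0n|rewrite ltr_wpDl// mulr_gt0// (lt_le_trans _ A8)].
pose eta := (6 * m%:R * M)^-1.
have eta0 : 0 < eta.
  by rewrite invr_gt0; apply: mulr_gt0 => //; apply: mulr_gt0; rewrite ltr0n.
have aa1 t : (0 < t)%N -> al t * la t <= 1.
  by move=> t0; rewrite ala//; exact: (step_bound_le1 G0 p12 mu01 hk gamma1).
have gfla i t w : (0 < t)%N -> enorm (gf i (x i t w)) <= la t / 2.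
  move=> t0; apply: le_trans (gfG i _ (Xx i t w t0)) _.
  by rewrite ler_pdivlMr// mulrC; exact: lambda_ge2G.
(* The constant [6] in [eta] makes this product exactly [al t * la t / 2]. *)
have small t : (0 < t)%N -> m%:R * (eta * al t * (2 * M) * (3 / 2 * la t)) <= 2^-1.
  move=> t0; have -> : m%:R * (eta * al t * (2 * M) * (3 / 2 * la t)) = (al t * la t) / 2.
    by rewrite /eta; field; rewrite (gt_eqF M0) pnatr_eq0 -lt0n m0.
  by rewrite ler_piMl ?invr_ge0// aa1.
(* The scaled weights add up to [2 / 3] of a partial sum of [C2] plus twice one of [C4], times [s];
   the index shift arises because the process starts at time [0]. *)
have bS T : \sum_(0 <= t < T)
    m%:R * moment_weight (m := m) (la t.+1) (eta * al t.+1) (2 * M) p * s <= S.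
  under eq_bigr => t _ do rewrite moment_weight_scaled//.
  rewrite -mulr_sumr ler_wpM2l// big_split -!mulr_sumr /=.
  have h2 := C2ub T.+1; have h4 := C4ub T.+1.
  rewrite !big_add1 /= in h2 h4.
  by move: h2 h4 C20; set u := \sum_(0 <= _ < _) _; set v := \sum_(0 <= _ < _) _; clear; lra.
have [E [mE [PE HE]]] := @noise_process_tail _ _ _ _ _ P g x gf xstar K M eta p s al la (ltW M0)
  (ltW eta0) p12 (fun t t0 => ltW (al0 t t0)) la0 gfla small mg ax
  (fun i t k => unbiased i t.+1 k isT) (fun i t => moment i t.+1 isT) S delta d01 erefl s0 m0 bS.
(* The event is fixed before [T]; from here on the argument is deterministic, along one outcome
   [w]. *)
exists E; split => //; split => // w Ew.
pose xw i t := x i t w; pose yw i t := y i t w; pose cw i t := clip (la t) (g i t w).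
have xw1 i : X (xw i 1%N) by rewrite /xw xx1.
have ale s' t : (0 < s')%N -> (s' <= t)%N -> al t * la t <= al s' * la s'.
  move=> s0' st; rewrite !ala ?(leq_trans s0' st)//.
  exact: (step_bound_le G0 p12 mu01 hk gamma1).
have R1w i : Num.sqrt (2 * bregman Phi gPhi xstar (xw i 1%N)) <= R1 by rewrite /xw xx1.
have aa0 t : 0 <= al t * la t.
  apply: mulr_ge0; last exact: ltW.
  by rewrite mulr_ge0 ?invr_ge0 ?mulr_ge0 ?powR_ge0// le_min !invr_ge0 powR_ge0 mulr_ge0// ltW.
have la2 t : 2 * G <= la t by exact: lambda_ge2G.
have al1 : al 1%N * la 1%N = 1 by rewrite ala// step_bound1.
have pb := @path_bound _ n m X f gf xstar Phi gPhi Per xw yw cw G R1 al la cX cf gradf Xstar sc A3 gfG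
  Per0 xw1 (fun i t t0 => Xy i t w t0) (fun i t z t0 => opt i t w z t0)
  (fun i t t0 => enorm_clip _ (la0 t)) (fun i t t0 => xy i t w t0) R1w al0 la2 ale al1 aa0 l.
pose D t := \sum_(i < m) bregman Phi gPhi xstar (xw i t).
have breg0 i t : (0 < t)%N -> 0 <= bregman Phi gPhi xstar (xw i t).
  move=> t0; apply: le_trans (bregman_ge sc Xstar (Xx i t w t0)).
  by rewrite mulr_ge0 ?sqr_ge0.
have D0 t : (0 < t)%N -> 0 <= D t by move=> t0; apply: sumr_ge0 => i _; exact: breg0.
have D1b : D 1%N <= m%:R * (R1 ^+ 2 / 2).
  apply: (@le_trans _ _ (\sum_(i < m) R1 ^+ 2 / 2)).
    by apply: ler_sum => i _; apply: (bregman_init Xstar sc xw1 R1w l i).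
  by rewrite sumr_const card_ord -[leLHS]mulr_natl.
have S1b T : \sum_(1 <= t < T.+1) (al t * la t) * (al (tau Per t) * la (tau Per t)) <= C1.
  apply: le_trans (C1ub T.+1).
  rewrite le_eqVlt; apply/orP; left; apply/eqP; apply: eq_bigr => t _; ring.
have S2b T : \sum_(1 <= t < T.+1) (al t * la t) ^+ 2 <= C1.
  apply: le_trans (S1b T); rewrite big_nat_cond [leRHS]big_nat_cond.
  apply: ler_sum => t /andP[/andP[t0 _] _]; rewrite expr2 ler_wpM2l//.
  by apply: ale; [exact: tau_gt0|exact: tau_le].
(* Divergences up to [M^2] keep all distances below [2 M], so no truncation acted and the stopped
   noise is [eta] times the true noise sum. Being below [K], it bounds that sum by [6 m M K], and
   [radius_dominates] closes the loop. *)
have invariant T : (forall t, (0 < t <= T)%N -> D t <= M ^+ 2) ->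
    \sum_(1 <= t < T.+1) al t * (\sum_(i < m) f i (xw l t) - \sum_(i < m) f i xstar)
      + D T.+1 <= M ^+ 2.
  move=> hD.
  have xM t i : (0 < t <= T)%N -> enorm (xw i t - xstar) <= 2 * M.
    move=> tT; have /andP[t0 _] := tT.
    rewrite -(@ler_pXn2r _ 2) ?nnegrE ?enorm_ge0//; last by rewrite mulr_ge0// ltW.
    have h1 := dist_le_bregman Xstar sc (Xx i t w t0).
    have h2 : bregman Phi gPhi xstar (xw i t) <= D t.
      rewrite /D (bigD1 i)//= lerDl; apply: sumr_ge0 => j _; exact: breg0.
    have h3 := hD t tT; have h4 := sqr_ge0 M; rewrite exprMn -/(xw i t) in h1 *.
    clear - h1 h2 h3 h4; lra.
  have hW := @stopped_noise_running _ _ _ gf xstar K M eta al la (fun i t => g i t w) xw T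
    (HE w Ew) xM.
  have hN : \sum_(1 <= t < T.+1) noise gf xstar xw cw al t <= 6 * m%:R * M * K.
    have := ltW (HE w Ew T); rewrite /noise_process hW mulrC -ler_pdivlMr// invrK mulrC.
    by [].
  apply: le_trans (pb T) _.
  apply: le_trans _ (@radius_dominates _ m%:R Per%:R R1 A K C1 (D 1%N)
    (\sum_(1 <= t < T.+1) (al t * la t) * (al (tau Per t) * la (tau Per t)))
    (\sum_(1 <= t < T.+1) (al t * la t) ^+ 2) M mR1 PR1 R10 C10 KA A8 CA D1b (S1b T) (S2b T) ME).
  by rewrite lerD2l.
have DM T : forall t, (0 < t <= T)%N -> D t <= M ^+ 2.
  elim: T => [|T IH] t; first by case: t.
  move=> /andP[t0]; rewrite leq_eqVlt => /predU1P[->|tT]; last by apply: IH; rewrite t0.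
  apply: le_trans (invariant T IH); rewrite lerDr.
  rewrite big_nat_cond; apply: sumr_ge0 => r /andP[/andP[r0 _] _].
  by rewrite mulr_ge0 ?(ltW (al0 _ r0))// subr_ge0 fmin//; exact: Xx.
move=> T T1; have aT := al0 T T1.
have TR : 0 < T%:R :> R by rewrite ltr0n.
pose F z := \sum_(i < m) f i z.
have cF : convex_on X F.
  move=> u v a Xu Xv a01; rewrite /F !mulr_sumr -big_split; apply: ler_sum => i _.
  exact: cf.
rewrite -/(F _) -/(F xstar).
have jens : F (T%:R^-1 *: \sum_(1 <= t < T.+1) x l t w) <=
    T%:R^-1 * \sum_(1 <= t < T.+1) F (x l t w).
  (* Reindexing from [0] matters for Jensen's inequality, which asks for all points of the family in
     [X]: nothing is known about [x l 0]. *)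
  rewrite !big_add1 /=.
  have := @jensen_average _ _ X F _ (fun t => x l t.+1 w) (index_iota 0 T) cX cF.
  by rewrite size_iota subn0; apply => // t; exact: Xx.
have Tal : 0 < T%:R * al T by exact: mulr_gt0.
rewrite ler_pdivlMl//.
have -> : m%:R ^+ 2 * (R1 + 10 * A) ^+ 2 = M ^+ 2 by rewrite ME exprMn.
have := invariant T (DM T); have := D0 T.+1 isT => hD0 hU.
apply: (@le_trans _ _ (al T * \sum_(1 <= t < T.+1) (F (x l t w) - F xstar))).
  rewrite mulrAC mulrC ler_pM2l//.
  rewrite sumrB sumr_const_nat subn1 /= -[F xstar *+ T]mulr_natl.
  have := jens; rewrite ler_pdivlMl// => h; by rewrite mulrBr lerD2r.
(* As [al] decreases and the gaps are nonnegative, the weight [al T] may be replaced by the larger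
   [al t]. *)
apply: (@le_trans _ _ (\sum_(1 <= t < T.+1) al t * (F (x l t w) - F xstar))); last first.
  by apply: le_trans hU; rewrite lerDl.
rewrite mulr_sumr big_nat_cond [leRHS]big_nat_cond.
apply: ler_sum => t /andP[/andP[t0 tT] _]; rewrite ler_wpM2r//.
  by rewrite subr_ge0 fmin//; exact: Xx.
exact: (alpha_le G0 p12 mu01 hk gamma1).
Qed.
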